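(* Let $f:\mathbb{R}\to\mathbb{R}$ be real analytic and let $\mathcal{M}_f=(\mathbb{R}^4,g_f)$, where, in coordinates $(x,y,\tilde x,\tilde y)$, the non-zero components (up to symmetry) of $g_f$ are $g_f(\partial_x,\partial_x)=-2f(y)$ and $g_f(\partial_x,\partial_{\tilde x})=g_f(\partial_y,\partial_{\tilde y})=1$. Then: (1) For every $k\ge 0$, the (possibly) non-zero components, up to the usual curvature symmetries, of the $k$-th covariant derivative $\nabla^kR_{\mathcal{M}_f}$ of the curvature tensor in the coordinate frame are $$\nabla^kR_{\mathcal{M}_f}(\partial_x,\partial_y,\partial_y,\partial_x;\partial_y,\dots,\partial_y)=f^{(k+2)}(y).$$ (2) All geodesics in $\mathcal{M}_f$ extend for infinite time. (3) For every $P\in\mathbb{R}^4$, the exponential map $\exp_{\mathcal{M}_f,P}:T_P\mathbb{R}^4\to\mathbb{R}^4$ is a diffeomorphism. (4) All the local scalar Weyl invariants of $\mathcal{M}_f$ vanish. (5) If $f^{(2)}$ never vanishes, then $\mathcal{M}_f$ is spacelike and timelike Jordan Osserman. (6) If $f^{(2)}$ never vanishes, then $\mathcal{M}_f$ is spacelike and timelike Jordan Ivanov-Petrova. (7) $\mathcal{M}_f$ is realizable as a hypersurface in $\mathbb{R}^{(2,3)}$, i.e. it is isometric to an embedded hypersurface with the induced metric.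
   Context: $f^{(j)}$ denotes the $j$-th derivative. Curvature conventions: $R(X,Y)=\nabla_X\nabla_Y-\nabla_Y\nabla_X-\nabla_{[X,Y]}$ and $R(X,Y,Z,W)=g(R(X,Y)Z,W)$; the arguments after the semicolon in $\nabla^kR$ are the directions of covariant differentiation. The local scalar Weyl invariants are the scalars obtained by completely contracting, with the metric, products of the tensors $\nabla^kR$, $k\ge0$. A vector $\xi$ is spacelike (timelike) if $g(\xi,\xi)>0$ ($<0$). The Jacobi operator is $J(\xi):\eta\mapsto R(\eta,\xi)\xi$. A pseudo-Riemannian manifold is spacelike (resp. timelike) Jordan Osserman if $J(\cdot)$ has constant Jordan normal form on the bundle of unit spacelike (resp. unit timelike) tangent vectors. If $\pi$ is an oriented spacelike or timelike $2$-plane (the restriction of $g$ to $\pi$ is positive, resp. negative, definite) with oriented orthonormal basis $\{e_1,e_2\}$, the skew-symmetric curvature operator is $R(\pi):=R(e_1,e_2)$. A pseudo-Riemannian manifold is spacelike (resp. timelike) Jordan Ivanov-Petrova if $R(\cdot)$ has constant Jordan normal form on the Grassmann bundle of oriented spacelike (resp. timelike) $2$-planes. $\mathbb{R}^{(2,3)}$ is $\mathbb{R}^5$ with the flat inner product of signature $(2,3)$: it has a basis $e_1,e_2,\tilde e_1,\tilde e_2,\check e$ whose only non-zero inner products are $\langle e_i,\tilde e_i\rangle=1$ and $\langle\check e,\check e\rangle=1$. *)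

(* Defs.v *)
From HB Require Import structures.
From mathcomp Require Import all_boot all_order all_algebra.
From mathcomp Require Import all_classical all_reals all_analysis.
From mathcomp Require Import complex.

Set Implicit Arguments.
Unset Strict Implicit.
Unset Printing Implicit Defensive.

Import Order.TTheory GRing.Theory Num.Theory.
Import numFieldNormedType.Exports.

Local Open Scope classical_set_scope.
Local Open Scope ring_scope.

Section Regularity.
Context {R : realType}.

Definition real_analytic (f : R -> R) :=
  forall x0 : R, exists (a : nat -> R) (r : R), 0 < r /\
    forall x, `|x - x0| < r -> pseries a (x - x0) @ \oo --> f x.

(* In finite dimension F is C^(k+1) iff it is differentiable and
   p |-> 'd F p v is C^k for every fixed v. *)
Fixpoint Ck {U V : normedModType R} (k : nat) (F : U -> V) : Prop :=
  if k is k'.+1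
  then (forall p, differentiable F p) /\
       (forall v : U, Ck k' (fun p => 'd F p v))
  else continuous F.

Definition smooth {U V : normedModType R} (F : U -> V) := forall k, Ck k F.

Definition diffeomorphism {U V : normedModType R} (F : U -> V) :=
  smooth F /\ exists G : V -> U, [/\ smooth G, cancel F G & cancel G F].

(* A smooth injective immersion that is a homeomorphism onto its image. *)
Definition smooth_embedding {U V : normedModType R} (F : U -> V) :=
  [/\ smooth F,
      (forall p v, 'd F p v = 0 -> v = 0) &
      exists G : V -> U, cancel F G /\ {within range F, continuous G}].

End Regularity.

Section JordanNormalForm.
Context {R : rcfType}.

(* A Jordan form is a list of blocks (eigenvalue, size), with complex
   eigenvalues. *)
Definition jordan_block (a : R[i]) (m : nat) : 'M[R[i]]_m :=
  \matrix_(i, j) (if i == j then a else ((i.+1 == j)%N)%:R).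

Fixpoint jordan_size (s : seq (R[i] * nat)) : nat :=
  if s is b :: s' then (b.2 + jordan_size s')%N else 0%N.

Fixpoint jordan_mx (s : seq (R[i] * nat)) : 'M[R[i]]_(jordan_size s) :=
  if s is b :: s' then block_mx (jordan_block b.1 b.2) 0 0 (jordan_mx s')
  else 0.

(* Since jordan_size s = n, row_free P says that P is invertible; the
   rectangular type of P avoids a cast. *)
Definition has_jordan_form n (A : 'M[R]_n) (s : seq (R[i] * nat)) :=
  [/\ jordan_size s = n, all (fun b => 0 < b.2)%N s &
      exists2 P : 'M[R[i]]_(jordan_size s, n), row_free P &
        P *m map_mx (real_complex R) A = jordan_mx s *m P].

Definition constant_jordan_form (I : Type) n (D : set I) (A : I -> 'M[R]_n) :=
  exists s, forall x, D x -> has_jordan_form (A x) s.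

End JordanNormalForm.

Section PseudoRiemannian.
Context {R : realType} {n : nat}.

(* Geometry of a metric g on R^n given by its component matrix in the standard
   chart; every tangent space is identified with 'rV[R]_n. *)
Local Notation V := 'rV[R]_n.
Variable g : V -> 'M[R]_n.

Definition frame (i : 'I_n) : V := delta_mx 0 i.

Definition ip (p u v : V) : R := \sum_i \sum_j g p i j * u 0 i * v 0 j.

Definition christoffel (k i j : 'I_n) (p : V) : R :=
  2^-1 * \sum_l invmx (g p) k l *
    ('D_(frame i) (fun q => g q j l) p + 'D_(frame j) (fun q => g q i l) p
     - 'D_(frame l) (fun q => g q i j) p).

Definition christ (p u v : V) : V :=
  \row_k \sum_i \sum_j christoffel k i j p * u 0 i * v 0 j.

Definition nabla (X Y : V -> V) : V -> V :=
  fun p => 'D_(X p) Y p + christ p (X p) (Y p).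

Definition lie (X Y : V -> V) : V -> V := fun p => 'D_(X p) Y p - 'D_(Y p) X p.

Definition curv (X Y Z : V -> V) : V -> V :=
  fun p => nabla X (nabla Y Z) p - nabla Y (nabla X Z) p - nabla (lie X Y) Z p.

(* Tensors act on tangent vectors at p, extended to constant coordinate
   vector fields wherever they have to be differentiated. *)
Definition curv_op (p u v w : V) : V := curv (cst u) (cst v) (cst w) p.

(* A covariant tensor field of rank r is only meaningful on argument lists of
   length r; other values are junk. *)
Definition tensor := V -> seq V -> R.

Definition riem : tensor := fun p vs =>
  ip p (curv_op p (nth 0 vs 0) (nth 0 vs 1) (nth 0 vs 2)) (nth 0 vs 3).

(* The direction of differentiation is the last argument:
   (nabla T)(v_1, .., v_r; w)
     = w (T(v_1, .., v_r)) - sum_i T(v_1, .., nabla_w v_i, .., v_r). *)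
Definition cov_deriv (T : tensor) : tensor := fun p vs =>
  let w := last 0 vs in
  let us := take (size vs).-1 vs in
  'D_w (fun q => T q us) p
  - \sum_(i < size us)
      T p (set_nth 0 us i (nabla (cst w) (cst (nth 0 us i)) p)).

Definition nabla_riem (k : nat) : tensor := iter k cov_deriv riem.

(* Complete contraction of the product of the nabla^k R, k in ks.  The N slots
   of the product are numbered consecutively and s lists the pairs of slots
   that are contracted together. *)
Definition weyl_shape (ks : seq nat) : seq nat := [seq (k + 4)%N | k <- ks].

Definition complete_pairing (N : nat) (s : seq ('I_N * 'I_N)) :=
  perm_eq (unzip1 s ++ unzip2 s) (enum 'I_N).

Definition weyl_contraction (ks : seq nat) (N := sumn (weyl_shape ks))
    (s : seq ('I_N * 'I_N)) (p : V) : R :=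
  \sum_(idx : N.-tuple 'I_n)
    (\prod_(ab <- s) invmx (g p) (tnth idx ab.1) (tnth idx ab.2)) *
    (\prod_(b <- zip ks (reshape (weyl_shape ks) (map frame idx)))
       nabla_riem b.1 p b.2).

(* The empty product is excluded: its value is the constant 1. *)
Definition scalar_weyl_invariants_vanish :=
  forall (ks : seq nat) (s : seq ('I_(sumn (weyl_shape ks)) * _)) (p : V),
    ks != [::] -> complete_pairing s -> weyl_contraction s p = 0.

Definition geodesic (I : set R) (c : R -> V) :=
  forall t, I t ->
    [/\ derivable c t 1, derivable (derive1 c) t 1 &
        derive1n 2 c t + christ (c t) (derive1 c t) (derive1 c t) = 0].

Definition open_interval (I : set R) := open I /\ is_interval I.

Definition geodesically_complete :=
  forall (I : set R) (c : R -> V), open_interval I -> geodesic I c ->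
    exists2 d : R -> V, geodesic setT d & forall t, I t -> d t = c t.

(* exp_P(v) = c(1) for the geodesic c with c(0) = P and c'(0) = v. *)
Definition exp_map (P v : V) : V :=
  get [set c : R -> V | exists I : set R,
    [/\ open_interval I, I 0, I 1, geodesic I c & c 0 = P /\ derive1 c 0 = v]] 1.

(* Operators are represented by matrices acting on row vectors. *)
Definition jacobi_op (p xi : V) : 'M[R]_n :=
  lin1_mx (fun eta => curv_op p eta xi xi).

Definition jordan_osserman (eps : R) :=
  constant_jordan_form [set z : V * V | ip z.1 z.2 z.2 = eps]
    (fun z => jacobi_op z.1 z.2).

Definition spacelike_jordan_osserman := jordan_osserman 1.
Definition timelike_jordan_osserman := jordan_osserman (-1).

(* An oriented definite 2-plane is given by an oriented orthonormal basis. *)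
Definition orthonormal_pair (eps : R) (p e1 e2 : V) :=
  [/\ ip p e1 e1 = eps, ip p e2 e2 = eps & ip p e1 e2 = 0].

Definition skew_curv_op (p e1 e2 : V) : 'M[R]_n := lin1_mx (curv_op p e1 e2).

Definition jordan_ivanov_petrova (eps : R) :=
  constant_jordan_form
    [set z : V * (V * V) | orthonormal_pair eps z.1 z.2.1 z.2.2]
    (fun z => skew_curv_op z.1 z.2.1 z.2.2).

Definition spacelike_jordan_ivanov_petrova := jordan_ivanov_petrova 1.
Definition timelike_jordan_ivanov_petrova := jordan_ivanov_petrova (-1).

(* (R^n, g) is isometric to an embedded hypersurface of R^(n+1) carrying the
   flat inner product with Gram matrix h. *)
Definition realizable_as_hypersurface (h : 'M[R]_n.+1) :=
  exists2 F : V -> 'rV[R]_n.+1, smooth_embedding F &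
    forall p u v : V,
      \sum_i \sum_j h i j * 'd F p u 0 i * 'd F p v 0 j = ip p u v.

End PseudoRiemannian.

Definition ix : 'I_4 := @Ordinal 4 0 isT.
Definition iy : 'I_4 := @Ordinal 4 1 isT.
Definition itx : 'I_4 := @Ordinal 4 2 isT.
Definition ity : 'I_4 := @Ordinal 4 3 isT.

Definition gf {R : realType} (f : R -> R) (p : 'rV[R]_4) : 'M[R]_4 :=
  \matrix_(i, j)
    if (i, j) == (ix, ix) then - (2 * f (p 0 iy))
    else ((i, j) \in [:: (ix, itx); (itx, ix); (iy, ity); (ity, iy)])%:R.

(* Gram matrix of R^(2,3) in the basis e_1, e_2, ~e_1, ~e_2, check e. *)
Definition flat23 {R : realType} : 'M[R]_5 :=
  \matrix_(i, j)
    ((val i, val j) \in [:: (0, 2); (2, 0); (1, 3); (3, 1); (4, 4)]%N)%:R.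

(* Main.v *)
(** Everything is explicit in the coordinates (x, y, ~x, ~y).  The only non-zero
    Christoffel terms are multiples of f'(y) and take values in the vertical
    plane spanned by d/d~x, d/d~y, on which they also vanish as functions of
    their arguments.  Hence R(u, v) w = f''(y) D(u, v) (w_y d/d~x - w_x d/d~y)
    with D(u, v) = u_x v_y - u_y v_x, covariant differentiation only differentiates
    the coefficient f'', and complete contractions vanish because the inverse
    metric vanishes on the pairs of indices in {x, y}.

    Along a geodesic x and y are affine, so ~x and ~y are obtained by two
    quadratures.  Smooth dependence on the initial velocity is Hadamard's lemma:
    the quotients of primitives of f by their argument are moments
    int_0^1 s^k phi(u s) ds, a class of functions stable under differentiation.
    The exponential map is triangular, with an explicit inverse. *)

Require Import Defs.
From HB Require Import structures.
From mathcomp Require Import all_boot all_order all_algebra.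
From mathcomp Require Import all_classical all_reals all_analysis.
From mathcomp Require Import complex ring lra.

Set Implicit Arguments.
Unset Strict Implicit.
Unset Printing Implicit Defensive.

Import Order.TTheory GRing.Theory Num.Theory.
Import numFieldNormedType.Exports.

Local Open Scope classical_set_scope.
Local Open Scope ring_scope.

(** * Analytic functions are smooth *)

Section PowerSeries.
Context {R : realType}.

(* [(i + 1) |z|^i (s - |z|) <= s^(i+1)] for [|z| < s], so the differentiated
   series at [z] is dominated by the original one at [s]. *)
Lemma is_cvg_pseries_diffs (a : nat -> R) (r : R) :
  (forall z, `|z| < r -> cvgn (pseries a z)) ->
  forall z, `|z| < r -> cvgn (pseries (pseries_diffs a) z).
Proof.
move=> ha z zr.
(* Two radii with [|z| < s < t < r]: convergence at [t] gives absolute convergence at [s], where the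
   dominating series lives. *)
pose s := (`|z| + r) / 2; pose t := (s + r) / 2.
have z0 : 0 <= `|z| by [].
have zs : `|z| < s by rewrite /s; lra.
have sr : s < r by rewrite /s; lra.
have st : s < t by rewrite /t; lra.
have tr : t < r by rewrite /t; lra.
have s0 : 0 < s by lra.
have cn : cvgn (pseries (fun i => `|a i|) s).
  apply: (@is_cvg_pseries_inside_norm _ a t); first by apply: ha; rewrite ger0_norm; lra.
  by rewrite !ger0_norm; lra.
apply: normed_cvg.
apply: (@series_le_cvg _ _ (fun i => (s - `|z|)^-1 * (`|a i.+1| * s ^+ i.+1))).
- by move=> n; exact: normr_ge0.
- move=> n; apply: mulr_ge0; first by rewrite invr_ge0 subr_ge0 ltW.
  by apply: mulr_ge0 => //; rewrite exprn_ge0// ltW.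
- move=> n /=; rewrite /pseries_diffs !normrM normrX ger0_norm//.
  rewrite ler_pdivlMl ?subr_gt0//.
  rewrite (_ : (s - _) * _ = `|a n.+1| * ((s - `|z|) * (n.+1%:R * `|z| ^+ n))); last by ring.
  rewrite ler_wpM2l//.
  apply: (@le_trans _ _ (s ^+ n.+1 - `|z| ^+ n.+1)); last first.
    by rewrite lerBlDr lerDl exprn_ge0.
  (* The cofactor of [s - |z|] in [s^(n+1) - |z|^(n+1)] is a sum of [n + 1] monomials of degree [n]
     in [s] and [|z|], each at least [|z|^n]. *)
  rewrite subrXX; apply: ler_wpM2l; first by rewrite subr_ge0 ltW.
  have -> : n.+1%:R * `|z| ^+ n = \sum_(i < n.+1) `|z| ^+ n.
    by rewrite sumr_const card_ord mulr_natl.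
  apply: ler_sum => i _; rewrite -{1}(subnK (ltnSE (ltn_ord i))) exprD.
  by rewrite ler_wpM2r ?exprn_ge0// lerXn2r// ?nnegrE 1?ltW.
- have [l hl] : exists l : R, [sequence \sum_(1 <= k < n) (`|a k| * s ^+ k)]_n @ \oo --> l.
    by apply/cvg_ex; rewrite (is_cvg_series_restrict 1 (fun k => `|a k| * s ^+ k)).
  have h : cvgn (series (fun i => `|a i.+1| * s ^+ i.+1)).
    rewrite -cvg_shiftS in hl; apply/cvg_ex; exists l.
    rewrite (_ : series _ = [sequence \sum_(1 <= k < n.+1) (`|a k| * s ^+ k)]_n)//.
    by apply/funext => n; rewrite /series/= big_add1.
  exact: (@is_cvg_seriesZ _ _ (s - `|z|)^-1 h).
Qed.

Lemma real_analytic_is_derive (f : R -> R) (x0 r : R) (a : nat -> R) :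
  (forall x, `|x - x0| < r -> pseries a (x - x0) @ \oo --> f x) ->
  forall x, `|x - x0| < r ->
    is_derive x 1 f (limn (pseries (pseries_diffs a) (x - x0))).
Proof.
move=> hf x xr.
have ca z : `|z| < r -> cvgn (pseries a z).
  move=> zr; apply/cvg_ex; exists (f (z + x0)).
  by have := hf (z + x0); rewrite addrK; apply.
have cd := is_cvg_pseries_diffs ca.
have cdd := is_cvg_pseries_diffs cd.
(* Termwise differentiation requires convergence of the series and of its first two formal
   derivatives at a point of modulus larger than [|x - x0|]; the midpoint [K] still lies inside the
   disc. *)
pose K := (`|x - x0| + r) / 2.
have x00 : 0 <= `|x - x0| by [].
have Kr : `|K| < r by rewrite /K ger0_norm; lra.
have xK : `|x - x0| < `|K| by rewrite /K [X in _ < X]ger0_norm; lra.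
have := pseries_snd_diffs (ca _ Kr) (cd _ Kr) (cdd _ Kr) xK.
move=> D.
have D2 : is_derive x 1 (fun x => x - x0) 1.
  by apply: is_derive_eq; rewrite subr0.
apply: (@near_eq_is_derive _ _ _ ((fun y => limn (pseries a y)) \o (fun x => x - x0))); last first.
  rewrite -[limn _]mulr1.
  exact: (@is_derive1_comp _ (fun y => limn (pseries a y)) (fun x => x - x0)).
have : \forall y \near x, `|y - x0| < r.
  have : (fun y => `|y - x0|) @ x --> `|x - x0|.
    by apply: cvg_norm; apply: cvgB; [exact: cvg_id|exact: cvg_cst].
  by move/cvgr_lt; apply.
apply: filterS => y /hf /cvg_lim /= -> //.
Qed.

Lemma real_analytic_derivable (f : R -> R) : real_analytic f ->
  forall x, derivable f x 1.
Proof.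
move=> hf x; have [a [r [r0 h]]] := hf x.
by have [] := @real_analytic_is_derive f x r a h x; rewrite ?subrr ?normr0.
Qed.

Lemma real_analytic_derive1 (f : R -> R) : real_analytic f -> real_analytic (derive1 f).
Proof.
move=> hf x0; have [a [r [r0 h]]] := hf x0.
exists (pseries_diffs a), r; split=> // x xr.
have [_ /= e] := real_analytic_is_derive h xr.
rewrite derive1E e; apply: (is_cvg_pseries_diffs (r := r)) => // z zr.
apply/cvg_ex; exists (f (z + x0)).
by have := h (z + x0); rewrite addrK; apply.
Qed.

End PowerSeries.

(** * Calculus of C^k maps *)

Section SmoothMaps.
Context {R : realType}.
Implicit Types U V : normedModType R.

Lemma Ck_cst U V k (c : V) : Ck k (cst c : U -> V).
Proof.
elim: k c => [|k IH] c; first by move=> ?; exact: cst_continuous.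
split=> [p|v]; first exact: differentiable_cst.
rewrite (_ : (fun p => _) = cst 0) //.
by apply/funext => p; rewrite diff_cst.
Qed.

Lemma CkW U V k (F : U -> V) : Ck k.+1 F -> Ck k F.
Proof.
elim: k F => [|k IH] F [dF cF]; first by move=> p; exact: differentiable_continuous.
by split=> // v; apply: IH; exact: cF.
Qed.

Lemma CkD U V k (F G : U -> V) : Ck k F -> Ck k G -> Ck k (fun p => F p + G p).
Proof.
elim: k F G => [|k IH] F G; first by move=> cF cG p; apply: continuousD; [exact: cF|exact: cG].
move=> [dF cF] [dG cG]; split=> [p|v]; first exact: (differentiableD (dF p) (dG p)).
rewrite (_ : (fun p => _) = fun p => 'd F p v + 'd G p v).
  by apply: IH; [exact: cF|exact: cG].
by apply/funext => p; rewrite (_ : (fun p => _) = F + G)// diffD.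
Qed.

Lemma CkM U k (F G : U -> R) : Ck k F -> Ck k G -> Ck k (fun p => F p * G p).
Proof.
elim: k F G => [|k IH] F G; first by move=> cF cG p; apply: continuousM; [exact: cF|exact: cG].
move=> cF cG; have [dF c'F] := cF; have [dG c'G] := cG.
split=> [p|v]; first exact: (differentiableM (dF p) (dG p)).
rewrite (_ : (fun p => _) = fun p => F p * 'd G p v + G p * 'd F p v).
  by apply: CkD; apply: IH; [exact: CkW|exact: c'G|exact: CkW|exact: c'F].
by apply/funext => p; rewrite (_ : (fun p => _) = F * G)// diffM.
Qed.

Lemma CkN U k (F : U -> R) : Ck k F -> Ck k (fun p => - F p).
Proof.
move=> cF; rewrite (_ : (fun p => _) = (fun p => cst (-1) p * F p)).
  by apply: CkM => //; exact: Ck_cst.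
by apply/funext => p /=; rewrite mulN1r.
Qed.

Lemma CkZl U V k (F : U -> R) (e : V) : Ck k F -> Ck k (fun p => F p *: e).
Proof.
elim: k F => [|k IH] F.
  move=> cF p; exact: (continuousZr_tmp (cF p)).
move=> [dF cF]; split=> [p|v]; first exact: differentiableZl.
rewrite (_ : (fun p => _) = fun p => 'd F p v *: e).
  by apply: IH; exact: cF.
by apply/funext => p; rewrite diffZl.
Qed.

Lemma Ck_linear U V k (F : {linear U -> V}) : continuous F -> Ck k F.
Proof.
move=> cF; case: k => [//|k]; split=> [p|v]; first exact: linear_differentiable.
rewrite (_ : (fun p => _) = cst (F v)); first exact: Ck_cst.
by apply/funext => p; rewrite diff_lin.
Qed.

Lemma coord_linear n (j : 'I_n) : linear (fun u : 'rV[R]_n => u 0 j).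
Proof. by move=> a u v; rewrite !mxE. Qed.

Lemma Ck_coord n k (j : 'I_n) : Ck k (fun u : 'rV[R]_n => u 0 j).
Proof.
pose f : {linear 'rV[R]_n -> R} :=
  HB.pack (fun u : 'rV[R]_n => u 0 j)
    (GRing.isLinear.Build _ _ _ _ _ (coord_linear j)).
exact: (Ck_linear k (F := f) (@coord_continuous _ _ _ 0 j)).
Qed.

Lemma diff_coord n (j : 'I_n) (p v : 'rV[R]_n) :
  'd (fun u : 'rV[R]_n => u 0 j : R) p v = v 0 j.
Proof.
pose f : {linear 'rV[R]_n -> R} :=
  HB.pack (fun u : 'rV[R]_n => u 0 j)
    (GRing.isLinear.Build _ _ _ _ _ (coord_linear j)).
by rewrite (@diff_lin _ _ _ f p (@coord_continuous _ _ _ 0 j)).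
Qed.

Lemma Ck_row U n k (F : U -> 'rV[R]_n) : (forall j, Ck k (fun p => F p 0 j)) -> Ck k F.
Proof.
move=> cF.
rewrite (_ : F = fun p => \sum_j F p 0 j *: delta_mx 0 j); last first.
  by apply/funext => p; exact: row_sum_delta.
elim: (index_enum _) => [|j s IH].
  rewrite (_ : (fun p => _) = cst 0); first exact: Ck_cst.
  by apply/funext => p; rewrite big_nil.
rewrite (_ : (fun p => _) = fun p => F p 0 j *: delta_mx 0 j +
  \sum_(j <- s) F p 0 j *: delta_mx 0 j).
  by apply: CkD; [exact/CkZl/cF|exact: IH].
by apply/funext => p; rewrite big_cons.
Qed.

Lemma diff_row U n (F : U -> 'rV[R]_n) p v j : differentiable F p ->
  ('d F p v) 0 j = 'd (fun q => F q 0 j : R) p v.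
Proof.
move=> dF.
have := diff_comp dF (@differentiable_coord _ _ _ (F p) 0 j).
rewrite (_ : _ \o _ = (fun q => F q 0 j))// => -> /=.
exact/esym/diff_coord.
Qed.

Lemma diff_scalar (phi : R -> R) x h : differentiable phi x ->
  'd phi x h = h * derive1 phi x.
Proof. by move=> d; rewrite diff1E. Qed.

Lemma Ck_derive1 k (phi : R -> R) : Ck k.+1 phi -> Ck k (derive1 phi).
Proof.
move=> [d c]; have := c 1; rewrite (_ : (fun p => _) = (derive1 phi)) //.
by apply/funext => p; rewrite diff_scalar// mul1r.
Qed.

Lemma Ck_comp U k (phi : R -> R) (F : U -> R) :
  Ck k phi -> Ck k F -> Ck k (fun p => phi (F p)).
Proof.
elim: k phi F => [|k IH] phi F; first by move=> c cF p; apply: continuous_comp; [exact: cF|exact: c].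
move=> c cF; have [dphi cphi] := c; have [dF c'F] := cF.
split=> [p|v]; first exact: (differentiable_comp (dF p) (dphi _)).
rewrite (_ : (fun p => _) = fun p => 'd F p v * derive1 phi (F p)).
  by apply: CkM; [exact: c'F|apply: IH; [exact: Ck_derive1|exact: CkW]].
apply/funext => p; rewrite (_ : (fun p => _) = phi \o F)// diff_comp//=.
exact: diff_scalar.
Qed.

Lemma smooth_derivable (phi : R -> R) x : smooth phi -> derivable phi x 1.
Proof. by move=> /(_ 1%N) [d _]; exact/derivable1_diffP. Qed.

Lemma smooth_derive1 (phi : R -> R) : smooth phi -> smooth (derive1 phi).
Proof. by move=> s k; exact: Ck_derive1. Qed.

Lemma smooth_continuous (phi : R -> R) : smooth phi -> continuous phi.
Proof. by move=> /(_ 0%N). Qed.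

(** Induction on [k] works because [P] passes to the derivative. The principle serves for classes
    closed under differentiation: analytic functions, and moments of smooth functions. *)
Lemma smooth_coind (P : (R -> R) -> Prop) :
  (forall phi x, P phi -> derivable phi x 1) ->
  (forall phi, P phi -> P (derive1 phi)) -> forall phi, P phi -> smooth phi.
Proof.
move=> dP P' phi Pphi k; elim: k phi Pphi => [|k IH] phi Pphi.
  by move=> x; exact/differentiable_continuous/derivable1_diffP/dP.
have d x : differentiable phi x by exact/derivable1_diffP/dP.
split=> // v.
rewrite (_ : (fun p => _) = fun p => cst v p * derive1 phi p).
  by apply: CkM; [exact: Ck_cst|exact/IH/P'].
by apply/funext => p; rewrite diff_scalar.
Qed.

Lemma smoothM (phi psi : R -> R) : smooth phi -> smooth psi ->
  smooth (fun x => phi x * psi x).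
Proof. by move=> a b k; exact: CkM. Qed.

Lemma smooth_id : smooth (id : R -> R).
Proof.
by move=> k; apply: (@Ck_linear R R k idfun) => x; exact: cvg_id.
Qed.

End SmoothMaps.

(** * Moments and Hadamard's lemma *)

Section Moments.
Context {R : realType}.

Local Notation mu := lebesgue_measure.

Lemma real_analytic_smooth (f : R -> R) : real_analytic f -> smooth f.
Proof.
apply: smooth_coind => [phi x h|phi]; first exact: real_analytic_derivable.
exact: real_analytic_derive1.
Qed.

Definition moment k (phi : R -> R) (u : R) : R :=
  \int[mu]_(s in `[0, 1]) (s ^+ k * phi (u * s)).

Lemma integrable_unit (h : R -> R) : continuous h ->
  mu.-integrable `[0, 1] (EFin \o h).
Proof.
move=> c; apply: continuous_compact_integrable; first exact: segment_compact.
exact: continuous_subspaceT.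
Qed.

Lemma is_derive_scale (u x : R) : is_derive x 1 (fun s : R => u * s) u.
Proof. by apply: is_derive_eq; rewrite [LHS]mulr1. Qed.

Lemma is_derive_smooth (phi : R -> R) (x : R) : smooth phi ->
  is_derive x 1 phi (derive1 phi x).
Proof. by move=> s; rewrite derive1E; exact/derivableP/smooth_derivable. Qed.

Lemma is_derive_smooth_scale (phi : R -> R) (u x : R) : smooth phi ->
  is_derive x 1 (fun s : R => phi (u * s)) (derive1 phi (u * x) * u).
Proof.
move=> s; exact: (is_derive1_comp (is_derive_smooth _ s) (is_derive_scale u x)).
Qed.

Lemma smooth_scale (phi : R -> R) (u : R) : smooth phi -> smooth (fun s : R => phi (u * s)).
Proof.
move=> s k; apply: Ck_comp => //; apply: CkM; [exact: Ck_cst|exact: smooth_id].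
Qed.

Lemma smoothX k : smooth (fun s : R => s ^+ k).
Proof.
elim: k => [|k IH]; first by move=> n; exact: Ck_cst.
rewrite (_ : (fun s : R => _) = fun s : R => s * s ^+ k).
  by apply: smoothM => //; exact: smooth_id.
by apply/funext => s; rewrite exprS.
Qed.

(** Differentiation under the integral sign: for [x] within distance 1 of [u] and [s] in [[0, 1]],
    the product [x * s] stays in [[-b, b]] with [b = |u| + 1], so the maximum of [|phi'|] on this
    compact interval is a constant dominating function. *)
Lemma moment_is_derive (k : nat) (phi : R -> R) (u : R) : smooth phi ->
  is_derive u 1 (moment k phi) (moment k.+1 (derive1 phi) u).
Proof.
move=> sphi.
pose f (x y : R) := y ^+ k * phi (x * y).
have sf x : smooth (f x) by apply: smoothM; [exact: smoothX|exact: smooth_scale].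
have df (x y : R) : is_derive x 1 (f ^~ y) (y ^+ k.+1 * derive1 phi (x * y)).
  have := is_derive_smooth_scale y x sphi.
  rewrite (_ : (fun s : R => phi (y * s)) = fun s : R => phi (s * y)); last first.
    by apply/funext => s; rewrite mulrC.
  move=> D; rewrite /f.
  have := @is_deriveZ R R R (fun s : R => phi (s * y)) (y ^+ k) x 1 _ D.
  rewrite (_ : _ \*: _ = (fun s : R => y ^+ k * phi (s * y)))// => D2.
  apply: is_derive_eq; rewrite exprSr [y * x]mulrC /GRing.scale/=; ring.
have pf x y : partial1of2 f x y = y ^+ k.+1 * derive1 phi (x * y).
  by rewrite partial1of2E; have [_ ->] := df x y.
pose b := `|u| + 1.
have b0 : - b <= b by rewrite /b; have := normr_ge0 u; lra.
have ch : continuous (fun x : R => `|derive1 phi x|).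
  move=> x; apply: continuous_comp; last exact: norm_continuous.
  exact/smooth_continuous/smooth_derive1.
have [c _ hc] := EVT_max b0 (continuous_subspaceT ch).
have Iu : u \in `]u - 1, u + 1[ by rewrite in_itv/=; lra.
have intf x : `]u - 1, u + 1[%classic x -> mu.-integrable `[0, 1] (EFin \o f x).
  by move=> _; exact/integrable_unit/smooth_continuous.
have derf x y : `]u - 1, u + 1[%classic x -> `[0, 1]%classic y -> derivable (f ^~ y) x 1.
  by move=> _ _; case: (df x y).
have G0 (y : R) : 0 <= cst `|derive1 phi c| y by [].
have intG : mu.-integrable `[0, 1] (EFin \o cst `|derive1 phi c|).
  by apply: integrable_unit => x; exact: cst_continuous.
have ub x y : `]u - 1, u + 1[%classic x -> `[0, 1]%classic y ->
    `|partial1of2 f x y| <= cst `|derive1 phi c| y.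
  rewrite /= !in_itv/= => /andP[x1 x2] /andP[y0 y1].
  have xb : `|x| <= b.
    by rewrite /b ler_norml; have := ler_norm u; have := ler_norm (- u); rewrite normrN; lra.
  rewrite pf normrM normrX (ger0_norm y0) -[leRHS]mul1r ler_pM ?exprn_ge0//.
    by rewrite exprn_ile1.
  apply: hc; rewrite in_itv/= -ler_norml normrM -[b]mulr1 ler_pM//.
  by rewrite ger0_norm.
have mI : measurable (`[0, 1]%classic : set R) by exact: measurable_itv.
have H1 := @derivable_under_integral R _ _ mu f _ mI u (u - 1) (u + 1) Iu intf derf _ G0 intG ub.
have H2 := @differentiation_under_integral R _ _ mu f _ mI u (u - 1) (u + 1) Iu intf derf _ G0 intG ub.
apply: (DeriveDef H1); rewrite -derive1E H2.
by apply: eq_Rintegral => y _; rewrite pf.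
Qed.

Lemma moment_smooth k (phi : R -> R) : smooth phi -> smooth (moment k phi).
Proof.
move=> s; apply: (@smooth_coind _ (fun g => exists n psi, smooth psi /\ g = moment n psi)); last by exists k, phi.
  by move=> g x [n [psi [spsi ->]]]; case: (moment_is_derive n x spsi).
move=> g [n [psi [spsi ->]]]; exists n.+1, (derive1 psi); split; first exact: smooth_derive1.
by apply/funext => x; rewrite derive1E; case: (moment_is_derive n x spsi).
Qed.

(* Integration of [(s phi(u s))'] over the unit interval. *)
Lemma moment_parts (phi : R -> R) (u : R) : smooth phi ->
  moment 0 phi u + u * moment 1 (derive1 phi) u = phi u.
Proof.
move=> sphi.
pose F s := s * phi (u * s).
pose h s := phi (u * s) + u * (s * derive1 phi (u * s)).
have sp : smooth (fun s : R => phi (u * s)) by exact: smooth_scale.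
have sp' : smooth (fun s : R => s * derive1 phi (u * s)).
  by apply: smoothM; [exact: smooth_id|exact/smooth_scale/smooth_derive1].
have sF : smooth F by apply: smoothM => //; exact: smooth_id.
have dF (x : R) : is_derive x 1 F (h x).
  have := @is_deriveM R R id (fun s : R => phi (u * s)) x 1 _ _
    (is_derive_id x 1) (is_derive_smooth_scale u x sphi).
  rewrite (_ : id * _ = F)// => D; apply: is_derive_eq.
  by rewrite /h /GRing.scale/=; ring.
have su : smooth (fun s : R => u * (s * derive1 phi (u * s))).
  by move=> n; apply: CkM; [exact: Ck_cst|exact: sp'].
have ch : continuous h.
  by apply: smooth_continuous => n; apply: CkD; [exact: sp|exact: su].
have := @continuous_FTC2 R h F 0 1 ltr01 (continuous_subspaceT ch).
have -> : F 1 = phi u by rewrite /F mul1r mulr1.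
have -> : F 0 = 0 by rewrite /F mul0r.
move=> H.
have {}H : \int[mu]_(s in `[0, 1]) h s = phi u.
  rewrite /Rintegral H ?sube0//.
  - split.
    + by move=> x _; exact: smooth_derivable.
    + exact/cvg_at_right_filter/(smooth_continuous sF).
    + exact/cvg_at_left_filter/(smooth_continuous sF).
  - by move=> x _; rewrite derive1E; case: (dF x).
rewrite -H RintegralD//; last 2 first.
- exact/integrable_unit/smooth_continuous.
- exact/integrable_unit/smooth_continuous.
rewrite RintegralZl//; last exact/integrable_unit/smooth_continuous.
congr (_ + _ * _); apply: eq_Rintegral => s _.
by rewrite expr0 mul1r.
Qed.

(** The substitution [s -> u s] turns the integral of [phi] from 0 to [u] into [u * moment 0 phi u],
    which is smooth because moments are; [moment_parts] identifies its derivative. *)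
Lemma smooth_antiderivative (phi : R -> R) : smooth phi ->
  exists F : R -> R, [/\ smooth F, F 0 = 0 & forall u : R, is_derive u 1 F (phi u)].
Proof.
move=> s; exists (fun u : R => u * moment 0 phi u); split.
- by apply: smoothM; [exact: smooth_id|exact: moment_smooth].
- by rewrite mul0r.
- move=> u; have := @is_deriveM R R id (moment 0 phi) u (1 : R) _ _
    (is_derive_id u 1) (moment_is_derive 0 u s).
  rewrite (_ : id * _ = fun u : R => u * moment 0 phi u)// => D; apply: is_derive_eq.
  by rewrite -[RHS](moment_parts u s) /GRing.scale/=; ring.
Qed.

(** The quotient is the mean of [phi'] over the segment from 0 to [u]. By [moment_parts] applied to
    [phi'], the difference of the two sides has zero derivative, and it vanishes at 0. *)
Lemma hadamard (phi : R -> R) : smooth phi -> phi 0 = 0 ->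
  exists q : R -> R, smooth q /\ forall u, phi u = u * q u.
Proof.
move=> s p0; exists (moment 0 (derive1 phi)); have s' := smooth_derive1 s; split.
  exact: moment_smooth.
move=> u; apply/eqP; rewrite -subr_eq0; apply/eqP.
rewrite [LHS](_ : _ = (fun v : R => phi v - v * moment 0 (derive1 phi) v) u)//.
have D0 (x : R) : is_derive x 1 (fun v : R => phi v - v * moment 0 (derive1 phi) v) 0.
  have D := @is_deriveM R R id (moment 0 (derive1 phi)) x 1 _ _
    (is_derive_id x 1) (moment_is_derive 0 x s').
  have := @is_deriveB R R R _ _ x 1 _ _ (is_derive_smooth x s) D.
  rewrite (_ : _ - _ = fun v : R => phi v - v * moment 0 (derive1 phi) v)// => D2.
  apply: is_derive_eq.
  transitivity (derive1 phi x -
      (moment 0 (derive1 phi) x + x * moment 1 (derive1 (derive1 phi)) x)).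
    by rewrite /GRing.scale/=; ring.
  by rewrite (moment_parts x s') subrr.
by rewrite (@is_derive_0_is_cst R _ u 0 D0) p0 mul0r subrr.
Qed.

End Moments.

(** * Connection and curvature *)

Section Coordinates.
Context {R : realType}.

Lemma sum4 (A : nmodType) (h : 'I_4 -> A) :
  \sum_i h i = h ix + h iy + h itx + h ity.
Proof.
rewrite !big_ord_recl big_ord0 !addrA addr0.
by congr (_ + _ + _ + _); congr h; apply/val_inj.
Qed.

Lemma ord4P (P : 'I_4 -> Prop) : P ix -> P iy -> P itx -> P ity -> forall i, P i.
Proof.
move=> Px Py Ptx Pty [[|[|[|[|//]]]] l].
- by rewrite (_ : Ordinal l = ix); last exact/val_inj.
- by rewrite (_ : Ordinal l = iy); last exact/val_inj.
- by rewrite (_ : Ordinal l = itx); last exact/val_inj.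
- by rewrite (_ : Ordinal l = ity); last exact/val_inj.
Qed.

Definition row4 (a b c d : R) : 'rV[R]_4 := \row_j nth 0 [:: a; b; c; d] j.

Lemma row4E a b c d : (row4 a b c d 0 ix = a) * (row4 a b c d 0 iy = b) *
  (row4 a b c d 0 itx = c) * (row4 a b c d 0 ity = d).
Proof. by rewrite /row4 !mxE. Qed.

Lemma row4_eq (u v : 'rV[R]_4) : u 0 ix = v 0 ix -> u 0 iy = v 0 iy ->
  u 0 itx = v 0 itx -> u 0 ity = v 0 ity -> u = v.
Proof. by move=> ex ey etx ety; apply/rowP; exact: ord4P. Qed.

Lemma frameE (a b : 'I_4) : @frame R 4 a 0 b = (a == b)%:R.
Proof. by rewrite /frame mxE eqxx eq_sym. Qed.

Lemma Ck_row4 (U : normedModType R) k (a b c d : U -> R) :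
  Ck k a -> Ck k b -> Ck k c -> Ck k d ->
  Ck k (fun p => row4 (a p) (b p) (c p) (d p)).
Proof.
move=> ca cb cc cd; apply: Ck_row; elim/ord4P.
- by rewrite (_ : (fun p => _) = a)//; apply/funext => p; rewrite row4E.
- by rewrite (_ : (fun p => _) = b)//; apply/funext => p; rewrite row4E.
- by rewrite (_ : (fun p => _) = c)//; apply/funext => p; rewrite row4E.
- by rewrite (_ : (fun p => _) = d)//; apply/funext => p; rewrite row4E.
Qed.

End Coordinates.

Section Metric.
Context {R : realType}.
Variable f : R -> R.
Implicit Types p q u v w : 'rV[R]_4.

Definition gf_inv p : 'M[R]_4 :=
  \matrix_(i, j)
    if (i, j) == (itx, itx) then 2 * f (p 0 iy)
    else ((i, j) \in [:: (ix, itx); (itx, ix); (iy, ity); (ity, iy)])%:R.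

Lemma invmx_gf p : invmx (gf f p) = gf_inv p.
Proof.
have e : gf f p *m gf_inv p = 1%:M.
  apply/matrixP => i j; rewrite mxE sum4 [RHS]mxE.
  elim/ord4P: i; elim/ord4P: j; rewrite !mxE /= ?(mulr0, mul0r, mulr1, mul1r, add0r, addr0)//.
  by rewrite addNr.
have [u _] := mulmx1_unit e.
by rewrite -[LHS]mulmx1 -e mulmxA mulVmx// mul1mx.
Qed.

Lemma ip_gf p u v : ip (gf f) p u v =
  - (2 * f (p 0 iy)) * u 0 ix * v 0 ix + u 0 ix * v 0 itx + u 0 itx * v 0 ix
  + u 0 iy * v 0 ity + u 0 ity * v 0 iy.
Proof.
rewrite /ip sum4 !(sum4 (fun j => _ * v 0 j)) !mxE /=.
ring.
Qed.

Lemma diff_comp_coord (phi : R -> R) (j : 'I_4) p :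
  (forall x, derivable phi x 1) ->
  differentiable (fun q : 'rV[R]_4 => phi (q 0 j)) p /\
  forall w, 'd (fun q : 'rV[R]_4 => phi (q 0 j)) p w = w 0 j * derive1 phi (p 0 j).
Proof.
move=> dphi; have d x : differentiable phi x by exact/derivable1_diffP.
have dc : differentiable (fun q : 'rV[R]_4 => q 0 j : R) p by exact: differentiable_coord.
split=> [|w]; first exact: (differentiable_comp dc (d _)).
rewrite (_ : (fun q => _) = phi \o (fun q : 'rV[R]_4 => q 0 j))//.
by rewrite diff_comp//= diff_scalar// diff_coord.
Qed.

Lemma derive_comp_coord (phi : R -> R) (j : 'I_4) p w (V : normedModType R) (e : V) :
  (forall x, derivable phi x 1) ->
  'D_w (fun q : 'rV[R]_4 => phi (q 0 j) *: e) p = (w 0 j * derive1 phi (p 0 j)) *: e.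
Proof.
move=> dphi; have [d dE] := diff_comp_coord j p dphi.
by rewrite deriveE ?diffZl ?dE//; exact: differentiableZl.
Qed.

Hypothesis sf : smooth f.

Lemma derive_gf (i j l : 'I_4) p : 'D_(frame i) (fun q => gf f q j l) p =
  if [&& i == iy, j == ix & l == ix] then - 2 * derive1 f (p 0 iy) else 0.
Proof.
have df x : derivable f x 1 by exact: smooth_derivable.
have [jl|jl] := eqVneq (j, l) (ix, ix).
  have -> : (fun q : 'rV[R]_4 => gf f q j l) = (fun q => f (q 0 iy) *: (- 2 : R)).
    apply/funext => q; rewrite mxE jl eqxx /GRing.scale/=; ring.
  rewrite derive_comp_coord// frameE; case: jl => -> ->; rewrite !eqxx !andbT.
  by case: eqP => _; rewrite /GRing.scale/= ?mul1r ?mul0r// mulrC.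
have -> : (fun q : 'rV[R]_4 => gf f q j l) = cst (gf f 0 j l).
  by apply/funext => q; rewrite !mxE (negbTE jl).
rewrite derive_cst; move: jl; rewrite xpair_eqE negb_and.
by case: (i == iy) => //=; case: (j == ix) => //=; case: (l == ix).
Qed.

Lemma christoffel_gf (k i j : 'I_4) p : christoffel (gf f) k i j p =
  derive1 f (p 0 iy) * ([&& k == ity, i == ix & j == ix]%:R
    - [&& k == itx, i == ix & j == iy]%:R - [&& k == itx, i == iy & j == ix]%:R).
Proof.
rewrite /christoffel invmx_gf sum4 !derive_gf.
by elim/ord4P: k; elim/ord4P: i; elim/ord4P: j; rewrite !mxE /=; field.
Qed.

Lemma christ_gf p u v : christ (gf f) p u v = derive1 f (p 0 iy) *:
  row4 0 0 (- (u 0 ix * v 0 iy + u 0 iy * v 0 ix)) (u 0 ix * v 0 ix).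
Proof.
apply: row4_eq; rewrite !mxE /= sum4 !(sum4 (fun j => _ * v 0 j)) !christoffel_gf /=; ring.
Qed.

Lemma nabla_cst (g : 'rV[R]_4 -> 'M[R]_4) v w : nabla g (cst v) (cst w) = fun q => christ g q v w.
Proof. by apply/funext => q; rewrite /nabla derive_cst add0r. Qed.

Lemma christ_christ p q u v w :
  christ (gf f) p u (christ (gf f) q v w) = 0.
Proof.
by rewrite !christ_gf; apply: row4_eq; rewrite !mxE /=; ring.
Qed.

Lemma derive_christ_gf p u v w : 'D_u (fun q => christ (gf f) q v w) p =
  (u 0 iy * derive1n 2 f (p 0 iy)) *:
    row4 0 0 (- (v 0 ix * w 0 iy + v 0 iy * w 0 ix)) (v 0 ix * w 0 ix).
Proof.
rewrite (_ : (fun q => _) = (fun q => derive1 f (q 0 iy) *: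
  row4 0 0 (- (v 0 ix * w 0 iy + v 0 iy * w 0 ix)) (v 0 ix * w 0 ix))); last first.
  by apply/funext => q; rewrite christ_gf.
by rewrite derive_comp_coord// => x; exact/smooth_derivable/smooth_derive1.
Qed.

Definition area u v : R := u 0 ix * v 0 iy - u 0 iy * v 0 ix.

Lemma curv_op_gf p u v w : curv_op (gf f) p u v w =
  (derive1n 2 f (p 0 iy) * area u v) *: row4 0 0 (w 0 iy) (- w 0 ix).
Proof.
rewrite /curv_op /curv !nabla_cst /nabla !christ_christ !derive_christ_gf.
rewrite (_ : lie _ _ = cst 0); last first.
  by apply/funext => q; rewrite /lie !derive_cst subrr.
rewrite derive0 christ_gf; apply: row4_eq; rewrite /area !mxE /=; ring.
Qed.

(** The factor of the k-th covariant derivative of R that does not depend on the point. The last two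
    curvature slots enter in reverse order, which makes the value on (x, y, y, x) equal to +1. *)
Definition curvature_form (vs : seq 'rV[R]_4) : R :=
  area (nth 0 vs 0) (nth 0 vs 1) * area (nth 0 vs 3) (nth 0 vs 2) *
  \prod_(w <- drop 4 vs) w 0 iy.

Definition vertical v := (v 0 ix == 0) && (v 0 iy == 0).

Lemma curvature_form_vertical v vs : vertical v -> v \in vs -> (4 <= size vs)%N ->
  curvature_form vs = 0.
Proof.
move=> /andP[/eqP vx /eqP vy].
case: vs => [|a [|b [|c [|d r]]]]//; rewrite /curvature_form /area /= drop0 !inE => vin _.
case/or4P: vin => [/eqP<-|/eqP<-|/eqP<-|]; try by rewrite vx vy; ring.
case/orP=> [/eqP<-|vr]; first by rewrite vx vy; ring.
by rewrite (big_rem v)//= vy; ring.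
Qed.

Lemma curvature_form_rcons vs w : (4 <= size vs)%N ->
  curvature_form (rcons vs w) = w 0 iy * curvature_form vs.
Proof.
case: vs => [|a [|b [|c [|d r]]]]// _; rewrite /curvature_form /= !drop0.
by rewrite -cats1 big_cat big_seq1 /=; ring.
Qed.

Lemma vertical_christ_gf p u v : vertical (christ (gf f) p u v).
Proof. by rewrite christ_gf /vertical !mxE /= !mulr0 eqxx. Qed.

Lemma smooth_derive1n k : smooth (derive1n k f).
Proof. by elim: k => [//|k IH]; rewrite derive1nS; exact: smooth_derive1. Qed.

(** Since [curvature_form] is constant in the point, differentiating in direction [w] only hits
    [f^(k+2)(y)], producing [w_y f^(k+3)(y)]; the factor [w_y] is what [curvature_form] gains from
    one more argument. *)
Lemma nabla_riem_gf k p vs : size vs = (k + 4)%N ->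
  nabla_riem (gf f) k p vs = derive1n k.+2 f (p 0 iy) * curvature_form vs.
Proof.
elim: k p vs => [|k IH] p vs svs.
  rewrite /nabla_riem /= /riem curv_op_gf ip_gf !mxE /=.
  case: vs svs => [|a [|b [|c [|d []]]]]//= _.
  rewrite /curvature_form /= big_nil /area; ring.
case/lastP: vs svs => [//|us w]; rewrite size_rcons addSn => -[sus].
have su4 : (4 <= size us)%N by rewrite sus leq_addl.
rewrite /nabla_riem iterS -/(nabla_riem (gf f) k) /cov_deriv last_rcons.
rewrite size_rcons /= -cats1 take_size_cat// cats1 curvature_form_rcons//.
(* Each correction term replaces one argument by a connection value, which is vertical, so the form
   vanishes on it. *)
rewrite big1 ?subr0; last first.
  move=> i _; rewrite nabla_cst IH; last by rewrite size_set_nth (maxn_idPr _).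
  rewrite (curvature_form_vertical (vertical_christ_gf p w (nth 0 us i))) ?mulr0//.
    set c := christ _ _ _ _; rewrite -[X in X \in _](_ : nth 0 (set_nth 0 us i c) i = c); last first.
      by rewrite nth_set_nth /= eqxx.
    by apply: mem_nth; rewrite size_set_nth leq_max leqnn.
  by rewrite size_set_nth leq_max su4 orbT.
rewrite (_ : (fun q => _) = (fun q => derive1n k.+2 f (q 0 iy) *: curvature_form us)); last first.
  by apply/funext => q; rewrite IH.
rewrite derive_comp_coord; last by move=> x; exact/smooth_derivable/smooth_derive1n.
by rewrite /GRing.scale /= mulrAC mulrC mulrA mulrAC -!mulrA mulrCA.
Qed.

Lemma area_frame a b : area (frame a) (frame b) != 0 :> R ->
  ((a, b) == (ix, iy)) || ((a, b) == (iy, ix)).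
Proof.
rewrite /area !frameE.
by elim/ord4P: a; elim/ord4P: b; rewrite //= ?(mulr0, mul0r) subrr ?eqxx.
Qed.

End Metric.

(** * Frame components of the covariant derivatives of R, and scalar Weyl invariants *)

Section Curvature.
Context {R : realType}.
Variable f : R -> R.
Hypothesis sf : smooth f.

Lemma nabla_riem_frames (k : nat) (p : 'rV[R]_4) :
  let nablaR (idx : seq 'I_4) := nabla_riem (gf f) k p (map (@frame R 4) idx) in
     [/\ nablaR ([:: ix; iy; iy; ix] ++ nseq k iy) = derive1n k.+2 f (p 0 iy),
         nablaR ([:: iy; ix; ix; iy] ++ nseq k iy) = derive1n k.+2 f (p 0 iy),
         nablaR ([:: ix; iy; ix; iy] ++ nseq k iy) = - derive1n k.+2 f (p 0 iy),
         nablaR ([:: iy; ix; iy; ix] ++ nseq k iy) = - derive1n k.+2 f (p 0 iy) &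
         forall idx : seq 'I_4, size idx = (k + 4)%N ->
           idx \notin [seq s ++ nseq k iy |
             s <- [:: [:: ix; iy; iy; ix]; [:: iy; ix; ix; iy];
                      [:: ix; iy; ix; iy]; [:: iy; ix; iy; ix]]] ->
           nablaR idx = 0].
Proof.
move=> nablaR.
have pr1 : \prod_(w <- map (@frame R 4) (nseq k iy)) w 0 iy = 1.
  by rewrite big_map big_nseq; elim: k {nablaR} => //= n ->; rewrite frameE mulr1.
have E a b c d : nablaR ([:: a; b; c; d] ++ nseq k iy) =
    derive1n k.+2 f (p 0 iy) * (area (frame a) (frame b) * area (frame d) (frame c)).
  rewrite /nablaR nabla_riem_gf//; last by rewrite size_map /= size_nseq addnC.
  by rewrite /curvature_form /= drop0 pr1 mulr1.
split; rewrite ?E /area ?frameE /=; try by ring.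
case=> [|a [|b [|c [|d r]]]]; try by rewrite addnC.
move=> sz nin.
rewrite /nablaR nabla_riem_gf//; last by rewrite size_map.
have sr : size r = k by move: sz; rewrite addnC => -[].
rewrite /curvature_form [drop _ _]/= drop0 [nth _ _ 0]/= [nth _ _ 1]/= [nth _ _ 2]/= [nth _ _ 3]/=.
(* A differentiation direction other than [iy] contributes a zero factor. Otherwise the tail is
   [nseq k iy], and both area factors must be non-zero, which leaves exactly the four excluded index
   patterns. *)
have [rk|] := boolP (all (pred1 iy) r); last first.
  rewrite -has_predC => /hasP[e er /= ey].
  by rewrite big_map (big_rem e)//= frameE (negbTE ey) mul0r !mulr0.
move/all_pred1P: rk; rewrite sr => er; subst r.
have [->|/area_frame ab] := eqVneq (area (frame a) (frame b) : R) 0; first by rewrite ?(mul0r, mulr0).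
have [->|/area_frame cd] := eqVneq (area (frame d) (frame c) : R) 0; first by rewrite ?(mul0r, mulr0).
move/negP: nin; case.
case/orP: ab => /eqP[-> ->]; case/orP: cd => /eqP[-> ->]; by rewrite !inE eqxx ?orbT.
Qed.

(** Cutting [l] into blocks puts [v] in some block, and the factor of that block vanishes; the
    induction asks whether it is the first one. *)
Lemma prod_nabla_riem_vertical (ks : seq nat) (l : seq 'rV[R]_4) p v :
  size l = sumn (weyl_shape ks) -> v \in l -> vertical v ->
  \prod_(b <- zip ks (reshape (weyl_shape ks) l)) nabla_riem (gf f) b.1 p b.2 = 0.
Proof.
elim: ks l => [|k ks IH] l /=; first by move/size0nil ->.
move=> sl vl vv; rewrite big_cons /=.
have st : size (take (k + 4) l) = (k + 4)%N by rewrite size_takel// sl leq_addr.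
move: vl; rewrite -{1}(cat_take_drop (k + 4) l) mem_cat => /orP[vt|vd].
  rewrite nabla_riem_gf// (curvature_form_vertical vv vt) ?mulr0 ?mul0r//.
  by rewrite st leq_addl.
by rewrite IH ?mulr0// size_drop sl addKn.
Qed.

(* A non-zero summand needs every index in {x, y}, where the inverse metric
   vanishes. *)
Lemma weyl_invariants_gf : scalar_weyl_invariants_vanish (gf f).
Proof.
move=> ks s p ks0 sP; rewrite /weyl_contraction big1// => idx _.
have N0 : (0 < sumn (weyl_shape ks))%N.
  by move: ks0; clear; case: ks => //= k ks _; rewrite addn4.
(* Every factor has at least four slots, so a complete pairing contains at least one pair [ab]; this
   single pair already kills the summand. *)
case: s sP => [|ab s] sP.
  by have := perm_size sP; rewrite /= size_enum_ord => e; rewrite -e in N0.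
pose V : pred 'I_4 := fun i => (i == itx) || (i == ity).
have vV i : V i -> vertical (@frame R 4 i).
  by rewrite /vertical !frameE => /orP[] /eqP->; rewrite eqxx.
have key i : V (tnth idx i) ->
    \prod_(b <- zip ks (reshape (weyl_shape ks) (map (@frame R 4) idx))) nabla_riem (gf f) b.1 p b.2 = 0.
  move=> /vV; apply: prod_nabla_riem_vertical; first by rewrite size_map size_tuple.
  by apply: map_f; exact: mem_tnth.
have [Va|nVa] := boolP (V (tnth idx ab.1)); first by rewrite (key _ Va) mulr0.
have [Vb|nVb] := boolP (V (tnth idx ab.2)); first by rewrite (key _ Vb) mulr0.
rewrite big_cons invmx_gf mxE; move: nVa nVb.
elim/ord4P: (tnth idx ab.1); elim/ord4P: (tnth idx ab.2) => //= _ _; by rewrite !mul0r.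
Qed.

End Curvature.

(** * Jordan forms *)

Section JordanForms.
Context {R : realType}.

(** Entries are indexed by plain naturals, so that for a concrete list they reduce by computation,
    without the dependent dimension and the block decomposition of [jordan_mx]. *)
Fixpoint jordan_entry (s : seq (R[i] * nat)) (i j : nat) : R[i] :=
  if s is b :: s' then
    if (i < b.2)%N then
      if (j < b.2)%N then (if i == j then b.1 else (i.+1 == j)%:R) else 0
    else if (j < b.2)%N then 0 else jordan_entry s' (i - b.2) (j - b.2)
  else 0.

Lemma jordan_mxE (s : seq (R[i] * nat)) i j : jordan_mx s i j = jordan_entry s i j.
Proof.
elim: s i j => [|b s IH] /=; first by case.
move=> i j; rewrite mxE; case: splitP => i' ei; rewrite mxE; case: splitP => j' ej.
- by rewrite /= ei ej mxE -val_eqE.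
- by rewrite mxE.
- by rewrite mxE.
- by rewrite /= IH ei ej !addKn.
Qed.

Lemma map_mx_complex_row_free n (P Q : 'M[R]_n) :
  P *m Q = 1%:M -> row_free (map_mx (real_complex R) P).
Proof.
move=> e; apply/row_freeP; exists (map_mx (real_complex R) Q).
by rewrite -map_mxM e map_mx1.
Qed.

Definition mx4 (rows : seq (seq R)) : 'M[R]_4 :=
  \matrix_(i, j) nth 0 (nth [::] rows i) j.

(** The Jordan types of the square-zero operators on a 4-dimensional space, of rank 1 here and of
    rank 2 below. *)
Definition jordan_rank1 : seq (R[i] * nat) := [:: (0, 2%N); (0, 1%N); (0, 1%N)].
Definition jordan_rank2 : seq (R[i] * nat) := [:: (0, 2%N); (0, 2%N)].

(** The only non-zero block of [A] is [c] times the outer square of [(b, -a)], hence of rank 1, and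
    it sends the (x, y)-plane to the vertical plane. *)
Lemma has_jordan_rank1 (a b c : R) (A : 'M[R]_4) : c != 0 -> a ^+ 2 + b ^+ 2 != 0 ->
  A = mx4 [:: [:: 0; 0; c * b * b; - (c * b * a)];
              [:: 0; 0; - (c * a * b); c * a * a];
              [::]; [::]] ->
  has_jordan_form A jordan_rank1.
Proof.
move=> c0 n0 eA; pose n := a ^+ 2 + b ^+ 2.
(* The rows of [P] are a Jordan basis for the action on row vectors: [(b, -a) / n] in the (x,
   y)-plane, its image [c (b, -a)] in the vertical plane, and [(a, b)] in each plane, both in the
   kernel. [Q] is the inverse. *)
pose P := mx4 [:: [:: b / n; - a / n; 0; 0]; [:: 0; 0; c * b; - (c * a)];
                  [:: a; b; 0; 0]; [:: 0; 0; a; b]].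
pose Q := mx4 [:: [:: b; 0; a / n; 0]; [:: - a; 0; b / n; 0];
                  [:: 0; b / (c * n); 0; a / n]; [:: 0; - a / (c * n); 0; b / n]].
have PQ : P *m Q = 1%:M.
  apply/matrixP => i j; rewrite mxE sum4 [RHS]mxE.
  by elim/ord4P: i; elim/ord4P: j; rewrite !mxE /= /n; field; rewrite ?n0 ?c0.
split=> //; exists (map_mx (real_complex R) P); first exact: map_mx_complex_row_free PQ.
have -> : (jordan_mx jordan_rank1 : 'M[R[i]]_(4, 4)) =
    map_mx (real_complex R) (mx4 [:: [:: 0; 1; 0; 0]; [::]; [::]; [::]]).
  apply/(@matrixP _ 4 4) => i j; rewrite (@jordan_mxE jordan_rank1 i j) [RHS]mxE mxE.
  by elim/ord4P: i; elim/ord4P: j; rewrite /= ?rmorph0 ?rmorph1.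
rewrite -[LHS]map_mxM -[RHS]map_mxM; congr map_mx.
apply/matrixP => i j; rewrite eA !mxE !sum4.
by elim/ord4P: i; elim/ord4P: j; rewrite !mxE /= /n; field.
Qed.

Lemma has_jordan_rank2 (c : R) (A : 'M[R]_4) : c != 0 ->
  A = mx4 [:: [:: 0; 0; 0; - c]; [:: 0; 0; c; 0]; [::]; [::]] ->
  has_jordan_form A jordan_rank2.
Proof.
move=> c0 eA.
(* Two chains of length 2: each of the first two basis vectors is followed by its image under
   [A]. *)
pose P := mx4 [:: [:: 1; 0; 0; 0]; [:: 0; 0; 0; - c];
                  [:: 0; 1; 0; 0]; [:: 0; 0; c; 0]].
pose Q := mx4 [:: [:: 1; 0; 0; 0]; [:: 0; 0; 1; 0];
                  [:: 0; 0; 0; c^-1]; [:: 0; - c^-1; 0; 0]].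
have PQ : P *m Q = 1%:M.
  apply/matrixP => i j; rewrite mxE sum4 [RHS]mxE.
  by elim/ord4P: i; elim/ord4P: j; rewrite !mxE /=; field.
split=> //; exists (map_mx (real_complex R) P); first exact: map_mx_complex_row_free PQ.
have -> : (jordan_mx jordan_rank2 : 'M[R[i]]_(4, 4)) =
    map_mx (real_complex R) (mx4 [:: [:: 0; 1; 0; 0]; [::]; [:: 0; 0; 0; 1]; [::]]).
  apply/(@matrixP _ 4 4) => i j; rewrite (@jordan_mxE jordan_rank2 i j) [RHS]mxE mxE.
  by elim/ord4P: i; elim/ord4P: j; rewrite /= ?rmorph0 ?rmorph1.
rewrite -[LHS]map_mxM -[RHS]map_mxM; congr map_mx.
apply/matrixP => i j; rewrite eA !mxE !sum4.
by elim/ord4P: i; elim/ord4P: j; rewrite !mxE /=; ring.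
Qed.

(** * The Osserman and Ivanov-Petrova properties *)

Variable f : R -> R.
Hypothesis sf : smooth f.
Hypothesis f2 : forall y, derive1n 2 f y != 0.

Lemma sqr_sum_neq0 (a b : R) : (a != 0) || (b != 0) -> a ^+ 2 + b ^+ 2 != 0.
Proof. by move=> ab; rewrite paddr_eq0 ?sqr_ge0// !sqrf_eq0 negb_and. Qed.

(** A vector whose x- and y-components both vanish is null. A non-null [xi] therefore has
    [xi_x^2 + xi_y^2 != 0], and its Jacobi operator has the rank 1 form with [a = xi_x], [b = xi_y]
    and [c = f''(y)]. *)
Lemma jordan_osserman_gf (eps : R) : eps != 0 -> jordan_osserman (gf f) eps.
Proof.
move=> eps0; exists jordan_rank1 => -[p xi] /= xie.
apply: (@has_jordan_rank1 (xi 0 ix) (xi 0 iy) (derive1n 2 f (p 0 iy))) => //.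
  apply: sqr_sum_neq0; rewrite -negb_and; apply/negP => /andP[/eqP xx /eqP xy].
  by move: eps0; rewrite -xie ip_gf xx xy !(mulr0, mul0r, addr0) eqxx.
apply/matrixP => i j; rewrite [LHS]mxE [RHS]mxE curv_op_gf// /area !mxE.
by elim/ord4P: i; elim/ord4P: j; rewrite /=; ring.
Qed.

(** The operator is [f''(y) * area u v] times a fixed square-zero map of rank 2, so everything rests
    on [area u v != 0]. *)
Lemma jordan_ivanov_petrova_gf (eps : R) : eps != 0 -> jordan_ivanov_petrova (gf f) eps.
Proof.
move=> eps0; exists jordan_rank2 => -[p [u v]] /= [uu vv uv].
apply: (@has_jordan_rank2 (derive1n 2 f (p 0 iy) * area u v)).
  rewrite mulf_neq0//; apply/eqP => a0.
  (* If the projections to the (x, y)-plane were dependent, the plane would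
     contain a vertical, hence null, vector. *)
  have key (s t : R) : s * u 0 ix + t * v 0 ix = 0 -> s * u 0 iy + t * v 0 iy = 0 ->
      s ^+ 2 + t ^+ 2 = 0.
    move=> ex ey.
    have : ip (gf f) p (s *: u + t *: v) (s *: u + t *: v) = 0.
      by rewrite ip_gf !mxE ex ey !(mulr0, mul0r, addr0).
    have -> : ip (gf f) p (s *: u + t *: v) (s *: u + t *: v) =
      s ^+ 2 * ip (gf f) p u u + t ^+ 2 * ip (gf f) p v v + 2 * s * t * ip (gf f) p u v.
      by rewrite !ip_gf !mxE; ring.
    rewrite uu vv uv mulr0 addr0 -mulrDl => /eqP.
    by rewrite mulf_eq0 (negbTE eps0) orbF => /eqP.
  (* The combination [v_x u - u_x v] has zero x-component, and its y-component is [- area u v = 0],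
     so [key] applies; [k2] treats [v_y u - u_y v] in the same way. Together they make [u] vertical,
     hence null, against [uu]. *)
  have k1 : v 0 ix ^+ 2 + u 0 ix ^+ 2 = 0.
    have := key (v 0 ix) (- u 0 ix); rewrite sqrrN; apply; first by ring.
    by rewrite -[RHS]oppr0 -a0 /area; ring.
  have k2 : v 0 iy ^+ 2 + u 0 iy ^+ 2 = 0.
    have := key (v 0 iy) (- u 0 iy); rewrite sqrrN; apply; last by ring.
    by rewrite -[RHS]a0 /area; ring.
  move: k1 k2 => /eqP; rewrite paddr_eq0 ?sqr_ge0// !sqrf_eq0 => /andP[/eqP vx /eqP ux].
  move/eqP; rewrite paddr_eq0 ?sqr_ge0// !sqrf_eq0 => /andP[/eqP vy /eqP uy].
  by move: eps0; rewrite -uu ip_gf ux uy !(mulr0, mul0r, addr0) eqxx.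
apply/matrixP => i j; rewrite [LHS]mxE [RHS]mxE curv_op_gf// !mxE.
by elim/ord4P: i; elim/ord4P: j; rewrite /=; ring.
Qed.

End JordanForms.

(** * Geodesics *)

Section Uniqueness.
Context {R : realType}.
Implicit Types (I : set R) (h k : R -> R).

Lemma is_derive_0_interval I h a b : is_interval I ->
  (forall t, I t -> is_derive t (1 : R) h 0) -> I a -> I b -> h a = h b.
Proof.
move=> iI; wlog ab : a b / a <= b => [W dh Ia Ib|dh Ia Ib].
  by case: (leP a b) => [|/ltW] ab; [|symmetry]; exact: W.
have Iab x : x \in `[a, b] -> I x by rewrite in_itv/=; exact: iI.
have cont : {within `[a, b], continuous h}.
  by apply: derivable_within_continuous => x /Iab /dh [].
have [x xab|c _] := @MVT_segment R h (fun=> 0) a b ab _ cont.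
  by apply/dh/Iab; move: xab; rewrite !in_itv/= => /andP[/ltW-> /ltW->].
by rewrite mul0r => /eqP; rewrite subr_eq0 => /eqP.
Qed.

Lemma is_derive_eq_interval I h k l t0 : is_interval I ->
  (forall t, I t -> is_derive t (1 : R) h (l t)) ->
  (forall t, I t -> is_derive t (1 : R) k (l t)) ->
  I t0 -> h t0 = k t0 -> forall t, I t -> h t = k t.
Proof.
move=> iI dh dk It0 e0 t It; apply/eqP; rewrite -subr_eq0; apply/eqP.
rewrite -[RHS](subrr (k t0)) -{1}e0.
apply: (@is_derive_0_interval I (fun s => h s - k s)) => // s Is.
have := @is_deriveB R R R h k s 1 _ _ (dh s Is) (dk s Is).
by rewrite subrr.
Qed.

End Uniqueness.

Section Geodesics.
Context {R : realType}.
Variable f : R -> R.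
Hypothesis sf : smooth f.
Implicit Types (P p q v : 'rV[R]_4) (c d : R -> 'rV[R]_4) (I : set R).

Lemma is_derive_row4 (a b c d : R -> R) (a' b' c' d' t : R) :
  is_derive t 1 a a' -> is_derive t 1 b b' -> is_derive t 1 c c' ->
  is_derive t 1 d d' ->
  is_derive t (1 : R) (fun s => row4 (a s) (b s) (c s) (d s)) (row4 a' b' c' d').
Proof.
move=> [da ea] [db eb] [dc ec] [dd ed].
pose m := fun s => row4 (a s) (b s) (c s) (d s).
have ma : (fun s => m s 0 ix) = a by apply/funext => s; rewrite row4E.
have mb : (fun s => m s 0 iy) = b by apply/funext => s; rewrite row4E.
have mc : (fun s => m s 0 itx) = c by apply/funext => s; rewrite row4E.
have md : (fun s => m s 0 ity) = d by apply/funext => s; rewrite row4E.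
have dm : derivable m t (1 : R).
  refine (proj2 (@derivable_mxP R R 1 4 m t 1) _) => i j; rewrite (ord1 i).
  elim/ord4P: j; [rewrite ma; exact: da|rewrite mb; exact: db|rewrite mc; exact: dc|rewrite md; exact: dd].
apply: (DeriveDef dm); rewrite derive_mx//.
by apply: row4_eq; rewrite mxE row4E ?ma ?mb ?mc ?md.
Qed.

Lemma is_derive_component c t (j : 'I_4) : derivable c t (1 : R) ->
  is_derive t (1 : R) (fun s => c s 0 j) (derive1 c t 0 j).
Proof.
move=> dc; apply: DeriveDef; first by move/derivable_mxP: dc; exact.
by rewrite derive1E derive_mx// mxE.
Qed.

(** Equal connection terms give equal accelerations, and two integrations from [t0] conclude.
    Working with one component at a time lets the components settled first supply the hypothesis for
    the others, in place of a general uniqueness theorem for differential equations. *)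
Lemma geodesic_component_unique I c d t0 (j : 'I_4) : is_interval I ->
  geodesic (gf f) I c -> geodesic (gf f) I d -> I t0 ->
  c t0 = d t0 -> derive1 c t0 = derive1 d t0 ->
  (forall t, I t -> christ (gf f) (c t) (derive1 c t) (derive1 c t) 0 j =
                    christ (gf f) (d t) (derive1 d t) (derive1 d t) 0 j) ->
  forall t, I t -> c t 0 j = d t 0 j /\ derive1 c t 0 j = derive1 d t 0 j.
Proof.
move=> iI gc gd It0 e0 e1 ecd.
have acc e t : geodesic (gf f) I e -> I t ->
    derive1 (derive1 e) t = - christ (gf f) (e t) (derive1 e t) (derive1 e t).
  by move=> ge It; have [_ _ /eqP] := ge t It; rewrite addr_eq0 => /eqP.
have acceq t : I t -> derive1 (derive1 c) t 0 j = derive1 (derive1 d) t 0 j.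
  by move=> It; rewrite (acc c t gc It) (acc d t gd It) [LHS]mxE [RHS]mxE (ecd t It).
have eq1 : forall t, I t -> derive1 c t 0 j = derive1 d t 0 j.
  apply: (@is_derive_eq_interval R I (fun t => derive1 c t 0 j) (fun t => derive1 d t 0 j)
    (fun t => derive1 (derive1 c) t 0 j) t0 iI _ _ It0).
  - by move=> s Is; have [_ ? _] := gc s Is; exact: is_derive_component.
  - by move=> s Is; have [_ ? _] := gd s Is; rewrite (acceq s Is); exact: is_derive_component.
  - by rewrite e1.
move=> t It; split; last exact: (eq1 t It).
move: t It; apply: (@is_derive_eq_interval R I (fun t => c t 0 j) (fun t => d t 0 j)
  (fun t => derive1 c t 0 j) t0 iI _ _ It0).
- by move=> s Is; have [? _ _] := gc s Is; exact: is_derive_component.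
- by move=> s Is; have [? _ _] := gd s Is; rewrite (eq1 s Is); exact: is_derive_component.
- by rewrite e0.
Qed.

Lemma christ_gf_ix p (u : 'rV[R]_4) v : christ (gf f) p u v 0 ix = 0.
Proof. by rewrite christ_gf// mxE row4E mulr0. Qed.

Lemma christ_gf_iy p (u : 'rV[R]_4) v : christ (gf f) p u v 0 iy = 0.
Proof. by rewrite christ_gf// mxE row4E mulr0. Qed.

Lemma christ_gf_eq p q (u : 'rV[R]_4) v : p 0 iy = q 0 iy -> u 0 ix = v 0 ix -> u 0 iy = v 0 iy ->
  christ (gf f) p u u = christ (gf f) q v v.
Proof. by move=> ep ex ey; rewrite !christ_gf// ep ex ey. Qed.

(** The x- and y-components come first, since the connection term has none. Along a curve the whole
    connection term depends only on y and on the x- and y-velocities, so it then agrees for both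
    curves and settles the remaining two components. *)
Lemma geodesic_unique I c d t0 : is_interval I ->
  geodesic (gf f) I c -> geodesic (gf f) I d -> I t0 ->
  c t0 = d t0 -> derive1 c t0 = derive1 d t0 -> forall t, I t -> c t = d t.
Proof.
move=> iI gc gd It0 e0 e1.
have U j := @geodesic_component_unique I c d t0 j iI gc gd It0 e0 e1.
have Ux : forall t, I t -> c t 0 ix = d t 0 ix /\ derive1 c t 0 ix = derive1 d t 0 ix.
  by apply: U => t It; exact: etrans (christ_gf_ix _ _ _) (esym (christ_gf_ix _ _ _)).
have Uy : forall t, I t -> c t 0 iy = d t 0 iy /\ derive1 c t 0 iy = derive1 d t 0 iy.
  by apply: U => t It; exact: etrans (christ_gf_iy _ _ _) (esym (christ_gf_iy _ _ _)).
have C t : I t -> christ (gf f) (c t) (derive1 c t) (derive1 c t) =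
                  christ (gf f) (d t) (derive1 d t) (derive1 d t).
  move=> It; have [_ ex] := Ux t It; have [ey ey'] := Uy t It.
  exact: christ_gf_eq.
move=> t It; apply: row4_eq; first by case: (Ux t It).
- by case: (Uy t It).
- exact: (U itx (fun s Is => congr1 (fun w : 'rV[R]_4 => w 0 itx) (C s Is)) t It).1.
- exact: (U ity (fun s Is => congr1 (fun w : 'rV[R]_4 => w 0 ity) (C s Is)) t It).1.
Qed.

(* [G u = int_0^1 f(y0 + s u) ds] and [H u = int_0^1 (1 - s) f'(y0 + s u) ds]. *)
Definition profile (y0 : R) (G H : R -> R) :=
  [/\ smooth G, smooth H, forall u, G u + u * derive1 G u = f (y0 + u) &
      forall u, G u - f y0 = u * H u].

Lemma is_derive_idM (phi : R -> R) (x : R) : smooth phi ->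
  is_derive x 1 (fun u => u * phi u) (phi x + x * derive1 phi x).
Proof.
move=> s; have := @is_deriveM R R id phi x 1 _ _ (is_derive_id x 1) (is_derive_smooth x s).
rewrite (_ : id * phi = fun u => u * phi u)// => D; apply: is_derive_eq.
by rewrite /GRing.scale/=; ring.
Qed.

(** Hadamard's lemma is used twice: [G] is the quotient by [u] of the primitive of [f(y0 + u)], and
    [H] that of [G u - f y0]. Differentiating [u G(u)] gives the third clause, whose value at 0 is
    [G 0 = f y0]. *)
Lemma profile_exists y0 : exists G H, profile y0 G H.
Proof.
have sphi : smooth (fun u => f (y0 + u)).
  by move=> k; apply: Ck_comp => //; apply: CkD; [exact: Ck_cst|exact: smooth_id].
have [F [sF F0 dF]] := smooth_antiderivative sphi.
have [G [sG FG]] := hadamard sF F0.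
have EG u : G u + u * derive1 G u = f (y0 + u).
  have [_ <-] := is_derive_idM u sG; have [_ <-] := dF u.
  by congr ('D_1 _ u); apply/funext => x; rewrite FG.
have G0 : G 0 = f y0 by rewrite -[y0 in RHS]addr0 -EG mul0r addr0.
have sG0 : smooth (fun u => G u - f y0).
  by move=> k; apply: CkD; [exact: sG|exact: Ck_cst].
have [|H [sH GH]] := hadamard sG0; first by rewrite G0 subrr.
by exists G, H; split.
Qed.

(** The two integrations of [tx'' = 2 v_x v_y f'(y)] and [ty'' = - v_x^2 f'(y)] along
    [y = P_y + t v_y]. Writing them with [G] and [H] avoids dividing by [v_y], so [v_y = 0] needs no
    separate case and the dependence on [v] is visibly smooth. *)
Definition geodesic_from (G H : R -> R) P v (t : R) : 'rV[R]_4 :=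
  row4 (P 0 ix + t * v 0 ix) (P 0 iy + t * v 0 iy)
    (P 0 itx + t * v 0 itx + 2 * v 0 ix * t * (G (t * v 0 iy) - f (P 0 iy)))
    (P 0 ity + t * v 0 ity - v 0 ix ^+ 2 * t ^+ 2 * H (t * v 0 iy)).

(** In the last component, [H + G'] at [u] is the mean of [f'] over the segment from [P_y] to
    [P_y + u]. *)
Definition velocity_from (G H : R -> R) P v (t : R) : 'rV[R]_4 :=
  row4 (v 0 ix) (v 0 iy)
    (v 0 itx + 2 * v 0 ix * (f (P 0 iy + t * v 0 iy) - f (P 0 iy)))
    (v 0 ity - v 0 ix ^+ 2 * t * (H (t * v 0 iy) + derive1 G (t * v 0 iy))).

Lemma is_derive_scale_arg (phi : R -> R) (b t : R) : smooth phi ->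
  is_derive t (1 : R) (fun s => phi (s * b)) (derive1 phi (t * b) * b).
Proof.
move=> s; have D : is_derive t (1 : R) (fun s => s * b) b.
  rewrite (_ : (fun s => _) = b \*: id); last by apply/funext => x; rewrite /= mulrC.
  by apply: is_derive_eq; rewrite /GRing.scale/= mulr1.
exact: (is_derive1_comp (is_derive_smooth _ s) D).
Qed.

Lemma is_derive_affine (a b t : R) : is_derive t (1 : R) (fun s => a + s * b) b.
Proof.
have D := @is_derive_scale_arg id b t smooth_id.
have := @is_deriveD R R R (cst a) (fun s => s * b) t 1 _ _ (is_derive_cst a t 1) D.
by rewrite add0r derive1_id mul1r.
Qed.

(** Obtained by differentiating the two identities of [profile]; they eliminate [H'] and [G''] when
    the explicit curve is differentiated twice. *)
Lemma profile_derive y0 G H : profile y0 G H -> forall u,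
  (H u + u * derive1 H u = derive1 G u) *
  (derive1 G u + derive1 G u + u * derive1 (derive1 G) u = derive1 f (y0 + u)).
Proof.
move=> [sG sH EG EH] u; split.
  have [_ <-] := is_derive_idM u sH.
  rewrite (_ : (fun u => u * H u) = (fun u => G u - f y0)); last by apply/funext => x; rewrite EH.
  have [_ ->] := @is_deriveB R R R G (cst (f y0)) u 1 _ _ (is_derive_smooth u sG) (is_derive_cst _ _ _).
  by rewrite subr0.
have sG' := smooth_derive1 sG.
have D1 := @is_deriveD R R R _ _ u 1 _ _ (is_derive_smooth u sG) (is_derive_idM u sG').
have D2 : is_derive u 1 (fun u => f (y0 + u)) (derive1 f (y0 + u)).
  rewrite -[derive1 f _]mulr1; apply: (is_derive1_comp (is_derive_smooth _ sf)).
  have := is_derive_affine y0 1 u.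
  by rewrite (_ : (fun s => _) = (fun s => y0 + s)) //; apply/funext => x; rewrite mulr1.
have [_ <-] := D2; rewrite -addrA; have [_ <-] := D1.
by congr ('D_1 _ u); apply/funext => x; rewrite -EG.
Qed.

Lemma geodesic_from_velocity G H P v t : profile (P 0 iy) G H ->
  is_derive t (1 : R) (geodesic_from G H P v) (velocity_from G H P v t).
Proof.
move=> pr; have [sG sH EG EH] := pr; have E := profile_derive pr.
have DG := is_derive_scale_arg (v 0 iy) t sG.
have DH := is_derive_scale_arg (v 0 iy) t sH.
have Dt := is_derive_id t (1 : R).
apply: is_derive_row4; try exact: is_derive_affine.
- have D0 := is_derive_affine (P 0 itx) (v 0 itx) t.
  have D1 := @is_deriveB R R R _ _ t 1 _ _ DG (is_derive_cst (f (P 0 iy)) t 1).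
  have D2 := @is_deriveM R R _ _ t 1 _ _ Dt D1.
  have D3 := @is_deriveZ R R R _ (2 * v 0 ix) t 1 _ D2.
  have := @is_deriveD R R R _ _ t 1 _ _ D0 D3.
  rewrite (_ : _ + _ = fun s => P 0 itx + s * v 0 itx +
    2 * v 0 ix * s * (G (s * v 0 iy) - f (P 0 iy))); last first.
    by apply/funext => s; rewrite !fctE /GRing.scale/= /GRing.scale/=; ring.
  move=> D; apply: is_derive_eq; rewrite -EG !fctE /GRing.scale/= /GRing.scale/=; ring.
- have D0 := is_derive_affine (P 0 ity) (v 0 ity) t.
  have D1 := @is_deriveM R R _ _ t 1 _ _ Dt (@is_deriveM R R _ _ t 1 _ _ Dt DH).
  have D3 := @is_deriveZ R R R _ (v 0 ix ^+ 2) t 1 _ D1.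
  have := @is_deriveB R R R _ _ t 1 _ _ D0 D3.
  rewrite (_ : _ - _ = fun s => P 0 ity + s * v 0 ity -
    v 0 ix ^+ 2 * s ^+ 2 * H (s * v 0 iy)); last first.
    by apply/funext => s; rewrite !fctE /GRing.scale/= /GRing.scale/=; ring.
  move=> D; apply: is_derive_eq; rewrite -(E _).1 !fctE /GRing.scale/= /GRing.scale/=; ring.
Qed.

Lemma velocity_from_acceleration G H P v t : profile (P 0 iy) G H ->
  is_derive t (1 : R) (velocity_from G H P v)
    (- christ (gf f) (geodesic_from G H P v t) (velocity_from G H P v t)
         (velocity_from G H P v t)).
Proof.
move=> pr; have [sG sH EG EH] := pr; have E := profile_derive pr.
rewrite christ_gf// !row4E.
have -> : - (derive1 f (P 0 iy + t * v 0 iy) *: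
      row4 0 0 (- (v 0 ix * v 0 iy + v 0 iy * v 0 ix)) (v 0 ix * v 0 ix)) =
    row4 0 0 (2 * v 0 ix * v 0 iy * derive1 f (P 0 iy + t * v 0 iy))
      (- (v 0 ix ^+ 2 * derive1 f (P 0 iy + t * v 0 iy))).
  by apply: row4_eq; rewrite !mxE /=; ring.
have Dt := is_derive_id t (1 : R).
apply: is_derive_row4; try exact: is_derive_cst.
- have Df := @is_derive1_comp R f (fun s => P 0 iy + s * v 0 iy) t _ _
    (is_derive_smooth (P 0 iy + t * v 0 iy) sf)
    (is_derive_affine (P 0 iy) (v 0 iy) t).
  have D1 := @is_deriveB R R R _ _ t 1 _ _ Df (is_derive_cst (f (P 0 iy)) t 1).
  have D2 := @is_deriveZ R R R _ (2 * v 0 ix) t 1 _ D1.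
  have D := @is_deriveD R R R _ _ t 1 _ _ (is_derive_cst (v 0 itx) t 1) D2.
  apply: (@is_derive_eq _ _ _ _ _ _ _ _ D); rewrite /GRing.scale/=; ring.
- have DG := is_derive_scale_arg (v 0 iy) t (smooth_derive1 sG).
  have DH := is_derive_scale_arg (v 0 iy) t sH.
  have D1 := @is_deriveM R R _ _ t 1 _ _ Dt (@is_deriveD R R R _ _ t 1 _ _ DH DG).
  have D2 := @is_deriveZ R R R _ (v 0 ix ^+ 2) t 1 _ D1.
  have := @is_deriveB R R R _ _ t 1 _ _ (is_derive_cst (v 0 ity) t 1) D2.
  rewrite (_ : _ - _ = fun s => v 0 ity -
    v 0 ix ^+ 2 * s * (H (s * v 0 iy) + derive1 G (s * v 0 iy))); last first.
    by apply/funext => s; rewrite !fctE /GRing.scale/= /GRing.scale/=; ring.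
  move=> D; apply: is_derive_eq; rewrite -(E _).2 -{1}(E _).1 !fctE /GRing.scale/= /GRing.scale/=; ring.
Qed.

Lemma geodesic_fromP G H P v : profile (P 0 iy) G H ->
  [/\ geodesic (gf f) setT (geodesic_from G H P v), geodesic_from G H P v 0 = P &
      derive1 (geodesic_from G H P v) 0 = v].
Proof.
move=> pr.
have D1 : derive1 (geodesic_from G H P v) = velocity_from G H P v.
  by apply/funext => t; rewrite derive1E; case: (geodesic_from_velocity v t pr).
split.
- move=> t _; have [d2 e2] := velocity_from_acceleration v t pr.
  split; first by case: (geodesic_from_velocity v t pr).
    by rewrite D1; exact: d2.
  by rewrite -[derive1n 2 _]/(derive1 (derive1 _)) D1 derive1E e2 addNr.
- by apply: row4_eq; rewrite row4E; ring.
- by rewrite D1; apply: row4_eq; rewrite row4E ?mul0r ?addr0; ring.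
Qed.

(** The explicit geodesic shows that the set under [get] is inhabited; whichever curve is chosen,
    uniqueness on its own interval forces its value at 1. *)
Lemma exp_map_gf G H P v : profile (P 0 iy) G H ->
  exp_map (gf f) P v = geodesic_from G H P v 1.
Proof.
move=> pr; have [gg g0 g1] := geodesic_fromP v pr.
rewrite /exp_map; set A := [set c | _].
have [I [[oI iI] I0 I1 gc [c0 c1]]] : A (get A).
  apply: getPex; exists (geodesic_from G H P v), setT; split=> //.
  by split; [exact: openT|].
exact: (@geodesic_unique I _ _ 0 iI gc (fun t _ => gg t Logic.I) I0
  (etrans c0 (esym g0)) (etrans c1 (esym g1)) 1 I1).
Qed.

Lemma is_derive_shift_time c (t t0 : R) l : is_derive (t - t0) (1 : R) c l ->
  is_derive t (1 : R) (fun s => c (s - t0)) l.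
Proof.
move=> [dc ec].
have e : (fun h : R => h^-1 *: (((fun s => c (s - t0)) \o shift t) (h *: 1) - c (t - t0))) =
         (fun h : R => h^-1 *: ((c \o shift (t - t0)) (h *: 1) - c (t - t0))).
  by apply/funext => h /=; rewrite addrA.
by apply: DeriveDef; rewrite /derivable /derive /= e.
Qed.

Lemma geodesic_shift_time c t0 : geodesic (gf f) setT c ->
  geodesic (gf f) setT (fun t => c (t - t0)) /\
  derive1 (fun t => c (t - t0)) = fun t => derive1 c (t - t0).
Proof.
move=> gc.
have D1 t : is_derive t (1 : R) (fun s => c (s - t0)) (derive1 c (t - t0)).
  by apply: is_derive_shift_time; have [d _ _] := gc (t - t0) Logic.I; rewrite derive1E; exact/derivableP.
have D2 t : is_derive t (1 : R) (fun s => derive1 c (s - t0)) (derive1 (derive1 c) (t - t0)).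
  by apply: is_derive_shift_time; have [_ d _] := gc (t - t0) Logic.I; rewrite [X in is_derive _ _ _ X]derive1E; exact/derivableP.
have E : derive1 (fun t => c (t - t0)) = fun t => derive1 c (t - t0).
  by apply/funext => t; rewrite derive1E; case: (D1 t).
split; last exact: E.
move=> t _; split; first by case: (D1 t).
  by rewrite E; case: (D2 t).
have [_ _] := gc (t - t0) Logic.I.
rewrite -![derive1n 2 _]/(derive1 (derive1 _)) E => <-.
by rewrite [in LHS]derive1E; case: (D2 t) => _ ->.
Qed.

Lemma geodesically_complete_gf : geodesically_complete (gf f).
Proof.
move=> J c [oJ iJ] gc.
(* On an empty interval any complete geodesic is an extension. Otherwise the extension is the
   explicit geodesic with the position and velocity of [c] at [t0], shifted in time by [t0]. *)
have [[t0 Jt0]|/forallNP nJ] := pselect (exists t, J t); last first.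
  have [G [H pr]] := profile_exists ((0 : 'rV[R]_4) 0 iy).
  have [gg _ _] := geodesic_fromP 0 pr.
  by exists (geodesic_from G H 0 0) => // t /nJ.
have [G [H pr]] := profile_exists (c t0 0 iy).
have [gg g0 g1] := geodesic_fromP (derive1 c t0) pr.
have [gs es] := geodesic_shift_time t0 gg.
pose d t := geodesic_from G H (c t0) (derive1 c t0) (t - t0).
have d0 : d t0 = c t0 by rewrite /d subrr.
have d1 : derive1 d t0 = derive1 c t0 by rewrite /d es subrr.
exists d; first exact: gs.
exact: (@geodesic_unique J _ _ t0 iJ (fun t _ => gs t Logic.I) gc Jt0 d0 d1).
Qed.

Lemma exp_map_gf_diffeomorphism P : diffeomorphism (exp_map (gf f) P).
Proof.
have [G [H pr]] := profile_exists (P 0 iy).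
have [sG sH _ _] := pr.
pose a (q : 'rV[R]_4) := q 0 ix - P 0 ix.
pose b (q : 'rV[R]_4) := q 0 iy - P 0 iy.
have eE : exp_map (gf f) P = fun v => row4 (P 0 ix + v 0 ix) (P 0 iy + v 0 iy)
    (P 0 itx + v 0 itx + 2 * v 0 ix * (G (v 0 iy) - f (P 0 iy)))
    (P 0 ity + v 0 ity - v 0 ix * v 0 ix * H (v 0 iy)).
  apply/funext => v; rewrite (exp_map_gf v pr) /geodesic_from !mul1r.
  by congr row4; ring.
(* The inverse: [a] and [b] recover [v_x] and [v_y], after which the non-linear terms of the last
   two components are known and can be removed. *)
pose L q := row4 (a q) (b q)
  (q 0 itx - P 0 itx - 2 * a q * (G (b q) - f (P 0 iy)))
  (q 0 ity - P 0 ity + a q * a q * H (b q)).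
have cst_ k (z : R) : Ck k (fun _ : 'rV[R]_4 => z) by exact: Ck_cst.
have ca k : Ck k a by apply: CkD; [exact: Ck_coord|].
have cb k : Ck k b by apply: CkD; [exact: Ck_coord|].
split.
  rewrite eE => k; apply: Ck_row4.
  - by apply: CkD => //; exact: Ck_coord.
  - by apply: CkD => //; exact: Ck_coord.
  - apply: CkD; first by apply: CkD => //; exact: Ck_coord.
    apply: CkM; first by apply: CkM => //; exact: Ck_coord.
    by apply: CkD => //; apply: Ck_comp => //; exact: Ck_coord.
  - apply: CkD; first by apply: CkD => //; exact: Ck_coord.
    apply: CkN; apply: CkM; first by apply: CkM; exact: Ck_coord.
    by apply: Ck_comp => //; exact: Ck_coord.
exists L; split.
- move=> k; apply: Ck_row4 => //.
  + apply: CkD; first by apply: CkD => //; exact: Ck_coord.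
    apply: CkN; apply: CkM; first exact: CkM.
    by apply: CkD => //; exact: Ck_comp.
  + apply: CkD; first by apply: CkD => //; exact: Ck_coord.
    by apply: CkM; [exact: CkM|exact: Ck_comp].
- move=> v; rewrite eE /L /a /b !row4E.
  have ex : P 0 ix + v 0 ix - P 0 ix = v 0 ix by ring.
  have ey : P 0 iy + v 0 iy - P 0 iy = v 0 iy by ring.
  by rewrite !ex !ey; apply: row4_eq; rewrite row4E; ring.
- move=> q; rewrite eE /L !row4E.
  by apply: row4_eq; rewrite row4E /a /b; ring.
Qed.

End Geodesics.

(** * The hypersurface *)

Section Hypersurface.
Context {R : realType}.
Variable f : R -> R.
Hypothesis sf : smooth f.

Definition row5 (a b c d e : R) : 'rV[R]_5 := \row_j nth 0 [:: a; b; c; d; e] j.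

Definition j5 k (lt_k5 : (k < 5)%N) : 'I_5 := Ordinal lt_k5.

Lemma ord5P (P : 'I_5 -> Prop) :
  P (@j5 0 isT) -> P (@j5 1 isT) -> P (@j5 2 isT) -> P (@j5 3 isT) -> P (@j5 4 isT) ->
  forall i, P i.
Proof.
move=> P0 P1 P2 P3 P4 [[|[|[|[|[|//]]]]] l].
- by rewrite (_ : Ordinal l = @j5 0 isT); last exact/val_inj.
- by rewrite (_ : Ordinal l = @j5 1 isT); last exact/val_inj.
- by rewrite (_ : Ordinal l = @j5 2 isT); last exact/val_inj.
- by rewrite (_ : Ordinal l = @j5 3 isT); last exact/val_inj.
- by rewrite (_ : Ordinal l = @j5 4 isT); last exact/val_inj.
Qed.

Lemma sum5 (A : nmodType) (h : 'I_5 -> A) :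
  \sum_i h i = h (@j5 0 isT) + h (@j5 1 isT) + h (@j5 2 isT) + h (@j5 3 isT) + h (@j5 4 isT).
Proof.
rewrite !big_ord_recl big_ord0 !addrA addr0.
by congr (_ + _ + _ + _ + _); congr h; apply/val_inj.
Qed.

Lemma Ck_row5 (U : normedModType R) k (a b c d e : U -> R) :
  Ck k a -> Ck k b -> Ck k c -> Ck k d -> Ck k e ->
  Ck k (fun p => row5 (a p) (b p) (c p) (d p) (e p)).
Proof.
move=> ca cb cc cd ce; apply: Ck_row; elim/ord5P.
- by rewrite (_ : (fun p => _) = a)//; apply/funext => p; rewrite mxE.
- by rewrite (_ : (fun p => _) = b)//; apply/funext => p; rewrite mxE.
- by rewrite (_ : (fun p => _) = c)//; apply/funext => p; rewrite mxE.
- by rewrite (_ : (fun p => _) = d)//; apply/funext => p; rewrite mxE.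
- by rewrite (_ : (fun p => _) = e)//; apply/funext => p; rewrite mxE.
Qed.

(* Graph-like ansatz [(x, y, tx + A, ty + B, h)] with [h = x^2/2 + f(y)], whose
   Hessian determinant is [f'']; then [A_x = - f - h_x^2/2], [B_y = - h_y^2/2]
   and [A_y + B_x + h_x h_y = 0].  [F] stands for a primitive of [f'^2]. *)
Definition immersion (F : R -> R) (p : 'rV[R]_4) : 'rV[R]_5 :=
  row5 (p 0 ix) (p 0 iy)
    (p 0 itx - (p 0 ix * f (p 0 iy) + 6^-1 * (p 0 ix * p 0 ix * p 0 ix)))
    (p 0 ity - 2^-1 * F (p 0 iy))
    (2^-1 * (p 0 ix * p 0 ix) + f (p 0 iy)).

Lemma is_diff_coord (j : 'I_4) (p : 'rV[R]_4) :
  is_diff p (fun q : 'rV[R]_4 => q 0 j : R) (fun v : 'rV[R]_4 => v 0 j : R).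
Proof.
apply: DiffDef; first exact: differentiable_coord.
by apply/funext => v; exact: diff_coord.
Qed.

Lemma is_diff_comp_coord (phi : R -> R) (j : 'I_4) (p : 'rV[R]_4) : smooth phi ->
  is_diff p (fun q : 'rV[R]_4 => phi (q 0 j) : R)
            (fun v : 'rV[R]_4 => v 0 j * derive1 phi (p 0 j) : R).
Proof.
move=> s; have [d dE] := diff_comp_coord j p (fun x => @smooth_derivable _ _ x s).
by apply: DiffDef => //; apply/funext => v; exact: dE.
Qed.

Section Immersion.
Variable F : R -> R.
Hypothesis sF : smooth F.
Hypothesis dF : forall y, derive1 F y = derive1 f y * derive1 f y.

Lemma smooth_immersion : smooth (immersion F).
Proof.
move=> k; have cst_ (z : R) : Ck k (fun _ : 'rV[R]_4 => z) by exact: Ck_cst.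
have cx : Ck k (fun p : 'rV[R]_4 => p 0 ix) by exact: Ck_coord.
have cy : Ck k (fun p : 'rV[R]_4 => p 0 iy) by exact: Ck_coord.
have cf : Ck k (fun p : 'rV[R]_4 => f (p 0 iy)) by exact: Ck_comp.
have cF : Ck k (fun p : 'rV[R]_4 => F (p 0 iy)) by exact: Ck_comp.
have cxx : Ck k (fun p : 'rV[R]_4 => p 0 ix * p 0 ix) by exact: CkM.
apply: Ck_row5 => //.
- apply: CkD; first exact: Ck_coord.
  by apply: CkN; apply: CkD; [exact: CkM|apply: CkM => //; exact: CkM].
- by apply: CkD; [exact: Ck_coord|apply: CkN; exact: CkM].
- by apply: CkD => //; exact: CkM.
Qed.

Lemma diff_immersion p v : 'd (immersion F) p v =
  row5 (v 0 ix) (v 0 iy)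
    (v 0 itx - (v 0 ix * f (p 0 iy) + p 0 ix * (v 0 iy * derive1 f (p 0 iy))
                + 2^-1 * (p 0 ix ^+ 2 * v 0 ix)))
    (v 0 ity - 2^-1 * (v 0 iy * derive1 f (p 0 iy) ^+ 2))
    (p 0 ix * v 0 ix + v 0 iy * derive1 f (p 0 iy)).
Proof.
have d : differentiable (immersion F) p by have [] := smooth_immersion 1.
have Dx := is_diff_coord ix p.
have Dtx := is_diff_coord itx p.
have Dty := is_diff_coord ity p.
have Df := is_diff_comp_coord iy p sf.
have DF := is_diff_comp_coord iy p sF.
have Dxx := @is_diffM R _ _ _ _ _ p Dx Dx.
apply/rowP => j; rewrite diff_row//; elim/ord5P: j; rewrite [RHS]mxE /=.
- rewrite (_ : (fun q => _) = (fun q : 'rV[R]_4 => q 0 ix)) ?diff_coord//.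
  by apply/funext => q; rewrite mxE.
- rewrite (_ : (fun q => _) = (fun q : 'rV[R]_4 => q 0 iy)) ?diff_coord//.
  by apply/funext => q; rewrite mxE.
- have D3 := @is_diffZ R _ _ _ _ 6^-1 p (@is_diffM R _ _ _ _ _ p Dxx Dx).
  have D := @is_diffB R _ _ _ _ _ _ p Dtx
    (@is_diffD R _ _ _ _ _ _ p (@is_diffM R _ _ _ _ _ p Dx Df) D3).
  rewrite (_ : (fun q => _) = ((fun q : 'rV[R]_4 => q 0 itx : R) -
    ((fun q : 'rV[R]_4 => q 0 ix : R) * (fun q : 'rV[R]_4 => f (q 0 iy)) +
     6^-1 \*: ((fun q : 'rV[R]_4 => q 0 ix : R) * (fun q : 'rV[R]_4 => q 0 ix : R) *
        (fun q : 'rV[R]_4 => q 0 ix : R))))); last by apply/funext => q; rewrite mxE.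
  rewrite (@diff_val _ _ _ _ _ _ _ D) !fctE /GRing.scale/=.
  by field.
- have D := @is_diffB R _ _ _ _ _ _ p Dty (@is_diffZ R _ _ _ _ 2^-1 p DF).
  rewrite (_ : (fun q => _) = ((fun q : 'rV[R]_4 => q 0 ity : R) -
    2^-1 \*: (fun q : 'rV[R]_4 => F (q 0 iy)))); last by apply/funext => q; rewrite mxE.
  rewrite (@diff_val _ _ _ _ _ _ _ D) !fctE dF /GRing.scale/=.
  by field.
- have D := @is_diffD R _ _ _ _ _ _ p (@is_diffZ R _ _ _ _ 2^-1 p Dxx) Df.
  rewrite (_ : (fun q => _) = (2^-1 \*: ((fun q : 'rV[R]_4 => q 0 ix : R) *
      (fun q : 'rV[R]_4 => q 0 ix : R)) +
    (fun q : 'rV[R]_4 => f (q 0 iy)))); last by apply/funext => q; rewrite mxE.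
  rewrite (@diff_val _ _ _ _ _ _ _ D) !fctE /GRing.scale/=.
  by field.
Qed.

(** The square of the differential of [h] is [(x dx + f' dy)^2]. Its [dx dy] and [dy^2] terms cancel
    against the corrections in the third and fourth coordinates, and the [dx^2] terms leave
    [- 2 f]. *)
Lemma immersion_isometric p u v :
  \sum_i \sum_j flat23 i j * 'd (immersion F) p u 0 i * 'd (immersion F) p v 0 j =
  ip (gf f) p u v.
Proof.
rewrite ip_gf !diff_immersion sum5 !(sum5 (fun j => _ * _ * row5 _ _ _ _ _ 0 j)) !mxE /=.
by field.
Qed.

(** The image is a graph over the first four coordinates: these are a triangular change of the
    original ones, so the differential is injective. *)
Lemma immersion_embedding : smooth_embedding (immersion F).
Proof.
split; first exact: smooth_immersion.
  move=> p v; rewrite diff_immersion => e.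
  have ej j : row5 (v 0 ix) (v 0 iy)
    (v 0 itx - (v 0 ix * f (p 0 iy) + p 0 ix * (v 0 iy * derive1 f (p 0 iy))
                + 2^-1 * (p 0 ix ^+ 2 * v 0 ix)))
    (v 0 ity - 2^-1 * (v 0 iy * derive1 f (p 0 iy) ^+ 2))
    (p 0 ix * v 0 ix + v 0 iy * derive1 f (p 0 iy)) 0 j = 0 by rewrite e mxE.
  have := ej (@j5 0 isT); have := ej (@j5 1 isT); have := ej (@j5 2 isT).
  have := ej (@j5 3 isT); rewrite !mxE /= => ety etx ey ex.
  rewrite ex ey in etx ety.
  rewrite !(mul0r, mulr0, addr0, subr0) in etx ety.
  by apply: row4_eq; rewrite [RHS]mxE.
pose X (q : 'rV[R]_5) : R := q 0 (@j5 0 isT).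
pose Y (q : 'rV[R]_5) : R := q 0 (@j5 1 isT).
(* A left inverse that ignores the fifth coordinate; it is continuous on the whole space, hence on
   the image. *)
pose L q := row4 (X q) (Y q)
  (q 0 (@j5 2 isT) + (X q * f (Y q) + 6^-1 * (X q * X q * X q)))
  (q 0 (@j5 3 isT) + 2^-1 * F (Y q)).
have cst_ (z : R) : Ck 0 (fun _ : 'rV[R]_5 => z) by exact: Ck_cst.
have cX : Ck 0 X by exact: Ck_coord.
have cY : Ck 0 Y by exact: Ck_coord.
have cL : Ck 0 L.
  apply: Ck_row4; [exact: cX|exact: cY|apply: CkD|apply: CkD].
  - exact: Ck_coord.
  - apply: CkD; first by apply: CkM; [exact: cX|exact: (Ck_comp (sf 0) cY)].
    apply: CkM; first exact: cst_.
    by apply: CkM; [apply: CkM; exact: cX|exact: cX].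
  - exact: Ck_coord.
  - by apply: CkM; [exact: cst_|exact: (Ck_comp (sF 0) cY)].
exists L; split; last exact: (continuous_subspaceT cL).
move=> p; rewrite /L /X /Y /immersion !mxE /=.
by apply: row4_eq; rewrite row4E// subrK.
Qed.

End Immersion.

Lemma realizable_gf : realizable_as_hypersurface (gf f) flat23.
Proof.
have sf' := smooth_derive1 sf.
have [F [sF _ dF]] := smooth_antiderivative (smoothM sf' sf').
have {}dF y : derive1 F y = derive1 f y * derive1 f y.
  by rewrite derive1E; case: (dF y).
exists (immersion F); first exact: immersion_embedding.
exact: immersion_isometric.
Qed.

End Hypersurface.

Theorem theorem1p3 (R : realType) (f : R -> R) (hf : real_analytic f) :
  (forall (k : nat) (p : 'rV[R]_4),
     let nablaR (idx : seq 'I_4) := nabla_riem (gf f) k p (map (@frame R 4) idx) in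
     [/\ nablaR ([:: ix; iy; iy; ix] ++ nseq k iy) = derive1n k.+2 f (p 0 iy),
         nablaR ([:: iy; ix; ix; iy] ++ nseq k iy) = derive1n k.+2 f (p 0 iy),
         nablaR ([:: ix; iy; ix; iy] ++ nseq k iy) = - derive1n k.+2 f (p 0 iy),
         nablaR ([:: iy; ix; iy; ix] ++ nseq k iy) = - derive1n k.+2 f (p 0 iy) &
         forall idx : seq 'I_4, size idx = (k + 4)%N ->
           idx \notin [seq s ++ nseq k iy |
             s <- [:: [:: ix; iy; iy; ix]; [:: iy; ix; ix; iy];
                      [:: ix; iy; ix; iy]; [:: iy; ix; iy; ix]]] ->
           nablaR idx = 0]) /\
  geodesically_complete (gf f) /\
  (forall P : 'rV[R]_4, diffeomorphism (exp_map (gf f) P)) /\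
  scalar_weyl_invariants_vanish (gf f) /\
  ((forall y : R, derive1n 2 f y != 0) ->
     spacelike_jordan_osserman (gf f) /\ timelike_jordan_osserman (gf f)) /\
  ((forall y : R, derive1n 2 f y != 0) ->
     spacelike_jordan_ivanov_petrova (gf f) /\
     timelike_jordan_ivanov_petrova (gf f)) /\
  realizable_as_hypersurface (gf f) flat23.
Proof.
have sf := real_analytic_smooth hf.
split; first exact: nabla_riem_frames.
split; first exact: geodesically_complete_gf.
split; first exact: exp_map_gf_diffeomorphism.
split; first exact: weyl_invariants_gf.
have n10 : (-1 : R) != 0 by rewrite oppr_eq0 oner_neq0.
split=> [f2|].
  by split; [exact: (jordan_osserman_gf sf f2 (oner_neq0 R))|exact: (jordan_osserman_gf sf f2 n10)].
split=> [f2|].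
  by split; [exact: (jordan_ivanov_petrova_gf sf f2 (oner_neq0 R))|exact: (jordan_ivanov_petrova_gf sf f2 n10)].
exact: realizable_gf.
Qed.
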